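(* Let $k$ be a field and $d$ a natural number. (1) (Subdivision) Let $\mathcal{D}$ be one of $\mathcal{T}$, $\mathcal{RT}$, or $\mathcal{T}_l$ (for some integer $l\ge2$), let $M$ be a $d$-smallish $k$-linear $\mathcal{D}^{\mathrm{op}}$-module, let $T$ be an object of $\mathcal{D}$, and let $\underline{e}=(e_1,\dots,e_r)$ be an $r$-tuple of distinct directed edges of $T$. Then there exists a polynomial $f_{M,T,\underline{e}}(t_1,\dots,t_r)$ of total degree at most $d$ such that, if $\underline{m}=(m_1,\dots,m_r)\in\mathbb{N}^r$ is sufficiently large in every coordinate, $$\dim_k M(T(\underline{e},\underline{m})) = f_{M,T,\underline{e}}(m_1,\dots,m_r).$$ (2) (Sprouting) Let $\mathcal{D}$ be one of $\mathcal{T}$ or $\mathcal{RT}$, let $M$ be a $d$-smallish $k$-linear $\mathcal{D}^{\mathrm{op}}$-module, let $T$ be an object of $\mathcal{D}$, and let $\underline{v}=(v_1,\dots,v_r)$ be an $r$-tuple of distinct vertices of $T$. Then there exists a polynomial $f_{M,T,\underline{v}}(t_1,\dots,t_r)$ of total degree at most $d$ such that, if $\underline{m}\in\mathbb{N}^r$ is sufficiently large in every coordinate, $$\dim_k M(T(\underline{v},\underline{m})) = f_{M,T,\underline{v}}(m_1,\dots,m_r).$$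
   Context: A tree is a finite nonempty connected acyclic graph; a leaf is a vertex of degree 1. A contraction $\varphi:T\to T'$ of trees is a map on vertex sets such that adjacent vertices of $T$ are sent to equal or adjacent vertices of $T'$, and the preimage of every vertex of $T'$ is the vertex set of a (nonempty, connected) subtree of $T$. Let $\mathcal{T}$ be the category of trees with contractions as morphisms. A rooted tree is a tree with a chosen vertex (the root); let $\mathcal{RT}$ be the category of rooted trees with contractions that send root to root. For an integer $l\ge 2$, let $\mathcal{T}_l\subset\mathcal{T}$ be the full subcategory of trees with at most $l$ leaves. For $\mathcal{D}\in\{\mathcal{T},\mathcal{RT},\mathcal{T}_l\}$, a ($k$-linear) $\mathcal{D}^{\mathrm{op}}$-module is a functor from $\mathcal{D}^{\mathrm{op}}$ to $k$-modules. For an object $S$ of $\mathcal{D}$, the principal projective $P_S$ is the $\mathcal{D}^{\mathrm{op}}$-module with $P_S(T)$ the free $k$-module on the set $\operatorname{Hom}_{\mathcal{D}}(T,S)$, with morphisms acting by composition. A $\mathcal{D}^{\mathrm{op}}$-module is generated in degrees $\le d$ if it is isomorphic to a quotient of a finite direct sum $\bigoplus_{i} P_{T_i}$ where each $T_i$ is an object of $\mathcal{D}$ with at most $d$ edges. It is $d$-small if it is isomorphic to a subquotient of a module generated in degrees $\le d$. It is $d$-smallish if it admits a (finite) filtration by submodules whose associated graded module is $d$-small. Subdivision: for $\underline{m}\in\mathbb{N}^r$, $T(\underline{e},\underline{m})$ is the tree obtained from $T$ by subdividing each edge $e_i$ into a path of $m_i$ edges (subdividing into $0$ edges means contracting $e_i$).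 Sprouting: $T(\underline{v},\underline{m})$ is the tree obtained from $T$ by attaching, for each $i$, $m_i$ new edges to the vertex $v_i$, each having a new leaf as its other endpoint. If $T$ is rooted, the new trees are rooted at (the image of) the root of $T$. *)

(* Defs.v *)
From HB Require Import structures.
(* [mpoly] comes first, as it shadows the relation predicate [symmetric]. *)
From mathcomp Require Import mpoly.
From mathcomp Require Import all_boot all_order all_algebra.

Set Implicit Arguments.
Unset Strict Implicit.
Unset Printing Implicit Defensive.

Import GRing.Theory.

Local Open Scope quotient_scope.
Local Open Scope ring_scope.

Record tree := Tree {
  vert :> finType;
  adj : rel vert;
  adj_sym : symmetric adj;
  adj_irr : irreflexive adj;
  tree_nonempty : (0 < #|vert|)%N;
  tree_connected : forall x y, connect adj x y;
  tree_acyclic : forall c : seq vert, ucycle adj c -> (size c <= 2)%N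
}.

Definition degree (T : tree) (x : T) : nat := #|[set y | adj x y]|.

Definition leaf (T : tree) (x : T) : bool := degree x == 1%N.

Definition num_leaves (T : tree) : nat := #|[set x : T | leaf x]|.

Definition num_edges (T : tree) : nat :=
  #|[set [set p.1; p.2] | p : T * T & adj p.1 p.2]|.

(* [A] is the vertex set of a subtree: the subgraph induced on [A] is nonempty
   and connected (it is acyclic because [T] is). *)
Definition subtree (T : tree) (A : {set T}) : bool :=
  (A != set0) &&
  [forall x in A, forall y in A,
     connect [rel u v | [&& u \in A, v \in A & adj u v]] x y].

Definition is_contraction (T T' : tree) (f : {ffun T -> T'}) : bool :=
  [forall x, forall y, adj x y ==> (f x == f y) || adj (f x) (f y)] &&
  [forall z, subtree (f @^-1: [set z])].

Definition contraction (T T' : tree) : Type :=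
  {f : {ffun T -> T'} | is_contraction f}.
HB.instance Definition _ T T' := Finite.on (contraction T T').

Section Cuts.

Lemma connect_cross (V : finType) (e : rel V) (P : pred V) x y :
  connect e x y -> P x -> ~~ P y -> exists a b, [/\ e a b, P a & ~~ P b].
Proof.
case/connectP=> p; elim: p x => [|z p IHp] x /=; first by move=> _ -> ->.
case/andP=> exz ez ey Px Py; case: (boolP (P z)) => Pz; first exact: (IHp z).
by exists x, z.
Qed.

(* The edge [xy] is the only one leaving the side [c] of the bipartition of
   the vertices given by [c]. *)
Definition cut (V : finType) (e : rel V) (c : pred V) (x y : V) : Prop :=
  [/\ c x, ~~ c y & forall u v, e u v -> c u -> ~~ c v -> u = x /\ v = y].

Lemma cut_acyclic (V : finType) (e : rel V) :
    symmetric e -> (forall x y, e x y -> exists c, cut e c x y) ->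
  forall s : seq V, ucycle e s -> (size s <= 2)%N.
Proof.
move=> esym ecut [|x [|y [|p0 p]]] //= /andP[/=].
case/and3P=> exy ey ep /and3P[].
rewrite !inE !negb_or => /and3P[xy xp0 xp] /andP[yp0 yp] _.
have [c [cx cy cc]] := ecut _ _ exy.
have c0 : ~~ c p0.
  apply/negP=> cp0; have [|e0 _] := cc p0 y _ cp0 cy; first by rewrite esym.
  by rewrite e0 eqxx in xp0.
suff step q z : path e z q -> y \notin belast z q -> ~~ c z -> ~~ c (last z q).
  have := step _ _ ep; rewrite belast_rcons last_rcons cx inE negb_or yp0 yp.
  by move=> /(_ isT c0).
elim: q z => //= w q IHq z /andP[ezw ew].
rewrite inE negb_or => /andP[yz yq] cz; apply: IHq => //.
apply/negP=> cw; have [|_ e1] := cc w z _ cw cz; first by rewrite esym.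
by rewrite e1 eqxx in yz.
Qed.

Lemma tree_cut (T : tree) (x y : T) :
  adj x y -> exists c, cut (@adj T) c x y.
Proof.
move=> exy.
pose e' := [rel u v : T | adj u v &&
   ~~ ((u == x) && (v == y) || (u == y) && (v == x))].
have cy : ~~ connect e' x y.
  apply/negP=> /connectP[p0 ep0 ey]; move: ey exy.
  case/shortenP: ep0 => p ep up _ ey exy.
  have : ucycle (@adj T) (x :: p).
    rewrite /ucycle up andbT /= rcons_path adj_sym -ey exy andbT.
    by apply: sub_path ep => u v /andP[].
  move/tree_acyclic; case: p ep up ey => [|z [|//]] /= ep up ey.
    by move: exy; rewrite ey adj_irr.
  by move: ep; rewrite ey !eqxx andbF.
exists (connect e' x); split=> // u v euv cu cv.
have [/andP[/eqP-> /eqP->] // | n1] := boolP ((u == x) && (v == y)).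
have [/andP[/eqP eu _] | n2] := boolP ((u == y) && (v == x)).
  by rewrite -eu cu in cy.
case/negP: cv; apply: connect_trans cu _; apply: connect1.
by rewrite /= euv negb_or n1 n2.
Qed.

Lemma cut_sym (V : finType) (e : rel V) c x y :
  symmetric e -> cut e c x y -> cut e (predC c) y x.
Proof.
move=> es [cx cy cc]; split=> //=; first by rewrite negbK.
move=> u v euv cu; rewrite negbK => cv.
by have [|-> ->] := cc v u _ cv cu; first by rewrite es.
Qed.

Lemma cut_leaf (T : tree) (x y : T) c :
  adj x y -> cut (@adj T) c x y -> exists2 t : T, leaf t & c t.
Proof.
move=> exy [cx cy cc].
suff main n z z' (s : seq T) : (#|T| <= size s + n)%N ->
    path (@adj T) z (z' :: s) -> uniq (z :: z' :: s) -> c z ->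
    y \in z' :: s -> exists2 t : T, leaf t & c t.
  apply: (main #|T| x y [::]) => //=; first by rewrite exy.
    rewrite inE andbT; apply/eqP=> exy'; move: exy.
    by rewrite exy' adj_irr.
  by rewrite inE.
elim: n z z' s => [|n IHn] z z' s.
  rewrite addn0 => le_s _ us; have := max_card (mem (z :: z' :: s)).
  by move/card_uniqP: us => -> /= /leq_trans /(_ le_s); rewrite ltnNge leqnSn.
move=> le_s ps us cz ys.
have [lz|] := boolP (leaf z); first by exists z.
rewrite /leaf /degree => nz.
have ezz' : adj z z' by case/andP: ps.
have [w] : exists w, w \in [set v | adj z v] :\ z'.
  apply/set0Pn; rewrite -card_gt0.
  by move: nz; rewrite (cardsD1 z') inE ezz' /=; case: #|_|.
rewrite !inE => /andP[wz' ezw].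
have wz : w != z.
  by apply/eqP=> ewz; move: ezw; rewrite ewz adj_irr.
have [ws|ws] := boolP (w \in s).
  case/path.splitP: ws ps us => s1 s2 ps us.
  suff /tree_acyclic : ucycle (@adj T) (z :: z' :: rcons s1 w).
    by rewrite /= size_rcons.
  rewrite /ucycle; apply/andP; split; last first.
    move: us; rewrite -[_ :: _]/((z :: z' :: rcons s1 w) ++ s2) cat_uniq.
    by case/andP.
  rewrite /cycle rcons_path /= last_rcons [adj w z]adj_sym ezw andbT.
  by move: ps; rewrite /= cat_path => /and3P[-> ->].
apply: (IHn w z (z' :: s)).
- by rewrite /= addSnnS.
- by rewrite /= adj_sym ezw; exact: ps.
- by rewrite cons_uniq us andbT !inE !negb_or wz wz'.
- apply: contraT => cw; have [_ ewy] := cc _ _ ezw cz cw.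
  by move: ys ws wz'; rewrite -ewy inE => /orP[|->] // ->.
- by rewrite inE ys orbT.
Qed.

End Cuts.

Section ContractionComp.

Lemma contractionP (T T' : tree) (f : {ffun T -> T'}) :
  reflect ((forall x y, adj x y -> f x = f y \/ adj (f x) (f y)) /\
           (forall z, subtree (f @^-1: [set z])))
          (is_contraction f).
Proof.
apply: (iffP andP) => -[H1 H2]; split.
- by move=> x y exy; have /forallP/(_ x)/forallP/(_ y)/implyP/(_ exy) := H1;
    case/orP=> [/eqP|]; [left|right].
- exact/forallP.
- apply/forallP=> x; apply/forallP=> y; apply/implyP=> exy.
  by case: (H1 _ _ exy) => [->|->]; rewrite ?eqxx ?orbT.
- exact/forallP.
Qed.

Lemma contraction_onto (T T' : tree) (f : {ffun T -> T'}) :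
  is_contraction f -> forall z, exists x, f x = z.
Proof.
case/contractionP=> _ H z; have /andP[/set0Pn[x]] := H z.
by rewrite !inE => /eqP; exists x.
Qed.

Lemma contraction_edge (T T' : tree) (f : {ffun T -> T'}) y z :
  is_contraction f -> adj y z -> exists a b, [/\ adj a b, f a = y & f b = z].
Proof.
move=> fC eyz; have [c [cy cz cc]] := tree_cut eyz.
have [x0 fx0] := contraction_onto fC y.
have [x1 fx1] := contraction_onto fC z.
have [||a [b [eab ca cb]]] :=
    @connect_cross T (@adj T) (fun x => c (f x)) x0 x1 (tree_connected _ _).
- by rewrite fx0.
- by rewrite fx1.
have [/(_ _ _ eab) [fab|fab] _] := contractionP _ fC.
  by rewrite -fab ca in cb.
by have [<- <-] := cc _ _ fab ca cb; exists a, b.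
Qed.

Lemma preim_subtree (T T' : tree) (f : {ffun T -> T'}) (B : {set T'}) :
  is_contraction f -> subtree B -> subtree (f @^-1: B).
Proof.
move=> fC /andP[/set0Pn[y0 By0] /forall_inP Bconn].
have [_ fib] := contractionP _ fC; apply/andP; split.
  have [x0 fx0] := contraction_onto fC y0.
  by apply/set0Pn; exists x0; rewrite inE fx0.
apply/forall_inP=> x; rewrite inE => Bx.
apply/forall_inP=> x'; rewrite inE => Bx'.
have /connectP[p] := forall_inP (Bconn _ Bx) _ Bx'.
have fiberP a b : f a \in B -> f a = f b ->
    connect [rel u v | [&& u \in f @^-1: B, v \in f @^-1: B & adj u v]] a b.
  move=> Ba eab; have /andP[_ /forall_inP/(_ a)] := fib (f a).
  rewrite !inE eqxx => /(_ isT)/forall_inP/(_ b).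
  rewrite !inE eab eqxx => /(_ isT).
  apply: connect_sub => u v; rewrite /= !inE -eab => /and3P[/eqP eu /eqP ev euv].
  by apply: connect1; rewrite /= !inE eu ev Ba.
elim: p x Bx => [|y p IHp] x Bx /=; first by move=> _ e; apply: fiberP.
case/andP=> /and3P[_ By exy] py ey'.
have [a [b [eab fa fb]]] := contraction_edge fC exy.
apply: (@connect_trans _ _ a); first by apply: fiberP.
apply: (@connect_trans _ _ b).
  by apply: connect1; rewrite /= !inE fa fb Bx By.
by apply: IHp; rewrite fb.
Qed.

Lemma contraction_id_subproof (T : tree) : is_contraction [ffun x : T => x].
Proof.
apply/contractionP; split=> [x y exy|z]; first by right; rewrite !ffunE.
apply/andP; split; first by apply/set0Pn; exists z; rewrite !inE ffunE.
apply/forall_inP=> x; rewrite !inE ffunE => /eqP->.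
by apply/forall_inP=> y; rewrite !inE ffunE => /eqP->.
Qed.

Lemma contraction_comp_subproof (T T' T'' : tree)
    (g : contraction T' T'') (f : contraction T T') :
  is_contraction [ffun x => val g (val f x)].
Proof.
case: g f => [g gC] [f fC] /=.
have [fE _] := contractionP _ fC; have [gE gF] := contractionP _ gC.
apply/contractionP; split=> [x y exy|z].
  rewrite !ffunE; case: (fE _ _ exy) => [->|]; first by left.
  exact: gE.
suff -> : [ffun x => g (f x)] @^-1: [set z] = f @^-1: (g @^-1: [set z]).
  exact: preim_subtree.
by apply/setP=> x; rewrite !inE ffunE.
Qed.

End ContractionComp.

Definition contraction_id (T : tree) : contraction T T :=
  exist (fun f => is_true (is_contraction f)) _ (contraction_id_subproof T).

Definition contraction_comp (T T' T'' : tree)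
    (g : contraction T' T'') (f : contraction T T') : contraction T T'' :=
  exist (fun f => is_true (is_contraction f)) _ (contraction_comp_subproof g f).

Lemma contraction_compE (T T' T'' : tree)
    (g : contraction T' T'') (f : contraction T T') x :
  val (contraction_comp g f) x = val g (val f x).
Proof. by rewrite ffunE. Qed.

Lemma contraction_comp1 (T T' : tree) (f : contraction T T') :
  contraction_comp f (contraction_id T) = f.
Proof. by apply/val_inj/ffunP=> x; rewrite !ffunE. Qed.

Lemma contraction_compA (T1 T2 T3 T4 : tree) (h : contraction T3 T4)
    (g : contraction T2 T3) (f : contraction T1 T2) :
  contraction_comp h (contraction_comp g f) =
  contraction_comp (contraction_comp h g) f.
Proof. by apply/val_inj/ffunP=> x; rewrite !ffunE. Qed.

(* Categories of trees, possibly with extra structure or property, whose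
   morphisms are contractions; composition is that of contractions. *)
Record treeCat := TreeCat {
  obj :> Type;
  utree : obj -> tree;
  is_mor : forall X Y : obj, pred (contraction (utree X) (utree Y));
  mor_id : forall X : obj, is_mor (contraction_id (utree X));
  mor_comp : forall (X Y Z : obj) (g : contraction (utree Y) (utree Z))
      (f : contraction (utree X) (utree Y)),
    is_mor g -> is_mor f -> is_mor (contraction_comp g f)
}.
Arguments is_mor {t X Y} _.
Arguments utree {t} _.

Definition hom (C : treeCat) (X Y : C) : Type :=
  {f : contraction (utree X) (utree Y) | is_mor f}.
HB.instance Definition _ C X Y := Finite.on (@hom C X Y).

Definition hom_id (C : treeCat) (X : C) : hom X X :=
  exist (fun f => is_true (is_mor f)) _ (mor_id X).

Definition hom_comp (C : treeCat) (X Y Z : C) (g : hom Y Z) (f : hom X Y) :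
  hom X Z :=
  exist (fun f => is_true (is_mor f)) _ (mor_comp (valP g) (valP f)).

Lemma hom_comp1 (C : treeCat) (X Y : C) (f : hom X Y) :
  hom_comp f (hom_id X) = f.
Proof. by apply/val_inj; apply: contraction_comp1. Qed.

Lemma hom_compA (C : treeCat) (X1 X2 X3 X4 : C) (h : hom X3 X4)
    (g : hom X2 X3) (f : hom X1 X2) :
  hom_comp h (hom_comp g f) = hom_comp (hom_comp h g) f.
Proof. by apply/val_inj; apply: contraction_compA. Qed.

Definition cat_T : treeCat :=
  @TreeCat tree id (fun _ _ _ => true) (fun _ => isT) (fun _ _ _ _ _ _ _ => isT).

Record rtree := RTree { rt_tree :> tree; root : rt_tree }.

Definition root_preserving (X Y : rtree) : pred (contraction X Y) :=
  fun f => val f (root X) == root Y.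
Arguments root_preserving {X Y} _.

Lemma root_preserving_id (X : rtree) : root_preserving (contraction_id X).
Proof. by rewrite /root_preserving /= ffunE. Qed.

Lemma root_preserving_comp (X Y Z : rtree) (g : contraction Y Z)
    (f : contraction X Y) :
  root_preserving g -> root_preserving f ->
  @root_preserving X Z (contraction_comp g f).
Proof.
by rewrite /root_preserving contraction_compE => /eqP gE /eqP->; rewrite gE.
Qed.

Definition cat_RT : treeCat :=
  @TreeCat rtree rt_tree (@root_preserving)
    root_preserving_id root_preserving_comp.

Definition cat_Tl (l : nat) : treeCat :=
  @TreeCat {T : tree | (num_leaves T <= l)%N} (@proj1_sig _ _)
    (fun _ _ _ => true) (fun _ => isT) (fun _ _ _ _ _ _ _ => isT).

Section Quotient.

Variables (k : fieldType) (V : lmodType k) (W : submodClosed V).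

Definition quot_rel : rel V := fun x y => x - y \in W.

Lemma sub_opp x : (- x \in W) = (x \in W).
Proof.
have opp y : y \in W -> - y \in W by move=> Wy; rewrite -scaleN1r rpredZ.
by apply/idP/idP => /opp; rewrite ?opprK.
Qed.

Lemma quot_rel_refl : reflexive quot_rel.
Proof. by move=> x; rewrite /quot_rel subrr rpred0. Qed.

Lemma quot_rel_sym : symmetric quot_rel.
Proof. by move=> x y; rewrite /quot_rel -opprB sub_opp. Qed.

Lemma quot_rel_trans : transitive quot_rel.
Proof.
move=> y x z; rewrite /quot_rel => xy yz.
by rewrite -[x](subrK y) -addrA rpredD.
Qed.

Canonical quot_equiv :=
  EquivRel quot_rel quot_rel_refl quot_rel_sym quot_rel_trans.

Definition lquot : Type := {eq_quot quot_equiv}.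
HB.instance Definition _ := Choice.on lquot.

Definition lpi (x : V) : lquot := \pi_({eq_quot quot_equiv})%qT x.

Definition lrepr (q : lquot) : V := repr q.

Lemma lreprK : cancel lrepr lpi.
Proof. exact: reprK. Qed.

Lemma lpi_eq x y : (lpi x = lpi y) <-> (x - y \in W).
Proof. by split=> [/eqmodP|] // H; apply/eqmodP. Qed.

Lemma lrepr_sub x : lrepr (lpi x) - x \in W.
Proof. by apply/lpi_eq; rewrite lreprK. Qed.

Definition lquot_add (p q : lquot) := lpi (lrepr p + lrepr q).
Definition lquot_opp (p : lquot) := lpi (- lrepr p).
Definition lquot_scale (a : k) (p : lquot) := lpi (a *: lrepr p).

Lemma lquot_addE x y : lquot_add (lpi x) (lpi y) = lpi (x + y).
Proof. by apply/lpi_eq; rewrite opprD addrACA rpredD ?lrepr_sub. Qed.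

Lemma lquot_oppE x : lquot_opp (lpi x) = lpi (- x).
Proof. by apply/lpi_eq; rewrite -opprD sub_opp lrepr_sub. Qed.

Lemma lquot_scaleE a x : lquot_scale a (lpi x) = lpi (a *: x).
Proof. by apply/lpi_eq; rewrite -scalerBr rpredZ ?lrepr_sub. Qed.

Lemma lquot_addA : associative lquot_add.
Proof.
move=> p q r; rewrite -[p]lreprK -[q]lreprK -[r]lreprK.
by rewrite !lquot_addE addrA.
Qed.

Lemma lquot_addC : commutative lquot_add.
Proof. by move=> p q; rewrite /lquot_add addrC. Qed.

Lemma lquot_add0 : left_id (lpi 0) lquot_add.
Proof. by move=> p; rewrite -[p]lreprK lquot_addE add0r. Qed.

Lemma lquot_addN : left_inverse (lpi 0) lquot_opp lquot_add.
Proof. by move=> p; rewrite -[p]lreprK lquot_oppE lquot_addE addNr. Qed.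

HB.instance Definition _ := GRing.isZmodule.Build lquot
  lquot_addA lquot_addC lquot_add0 lquot_addN.

Lemma lquot_scaleA a b p : lquot_scale a (lquot_scale b p) = lquot_scale (a * b) p.
Proof. by rewrite -[p]lreprK !lquot_scaleE scalerA. Qed.

Lemma lquot_scale1 : left_id 1 lquot_scale.
Proof. by move=> p; rewrite -[p]lreprK lquot_scaleE scale1r. Qed.

Lemma lquot_scaleDr : right_distributive lquot_scale +%R.
Proof.
move=> a p q; rewrite -[p]lreprK -[q]lreprK -[_ + _]/(lquot_add _ _).
rewrite lquot_addE !lquot_scaleE -[RHS]/(lquot_add _ _) lquot_addE.
by rewrite scalerDr.
Qed.

Lemma lquot_scaleDl p : {morph lquot_scale^~ p : a b / a + b}.
Proof.
move=> a b; rewrite -[p]lreprK !lquot_scaleE -[RHS]/(lquot_add _ _) lquot_addE.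
by rewrite scalerDl.
Qed.

HB.instance Definition _ := GRing.Zmodule_isLmodule.Build k lquot
  lquot_scaleA lquot_scale1 lquot_scaleDr lquot_scaleDl.

Lemma lpi_is_linear : linear lpi.
Proof.
move=> a x y; rewrite -[RHS]/(lquot_add (lquot_scale _ _) _).
by rewrite lquot_scaleE lquot_addE.
Qed.

HB.instance Definition _ := GRing.isLinear.Build k V lquot _ lpi lpi_is_linear.

End Quotient.

Section DirectSum.

Variables (k : fieldType) (I : finType) (V : I -> lmodType k).

Definition dsum : Type := {dffun forall i, V i}.
HB.instance Definition _ := Choice.on dsum.

Definition dsum_zero : dsum := [ffun i => 0 : V i].
Definition dsum_opp (x : dsum) : dsum := [ffun i => - x i : V i].
Definition dsum_add (x y : dsum) : dsum := [ffun i => x i + y i : V i].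
Definition dsum_scale (a : k) (x : dsum) : dsum := [ffun i => a *: x i : V i].

Lemma dsum_addA : associative dsum_add.
Proof. by move=> x y z; apply/ffunP=> i; rewrite !ffunE addrA. Qed.

Lemma dsum_addC : commutative dsum_add.
Proof. by move=> x y; apply/ffunP=> i; rewrite !ffunE addrC. Qed.

Lemma dsum_add0 : left_id dsum_zero dsum_add.
Proof. by move=> x; apply/ffunP=> i; rewrite !ffunE add0r. Qed.

Lemma dsum_addN : left_inverse dsum_zero dsum_opp dsum_add.
Proof. by move=> x; apply/ffunP=> i; rewrite !ffunE addNr. Qed.

HB.instance Definition _ := GRing.isZmodule.Build dsum
  dsum_addA dsum_addC dsum_add0 dsum_addN.

Lemma dsum_scaleA a b x : dsum_scale a (dsum_scale b x) = dsum_scale (a * b) x.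
Proof. by apply/ffunP=> i; rewrite !ffunE scalerA. Qed.

Lemma dsum_scale1 : left_id 1 dsum_scale.
Proof. by move=> x; apply/ffunP=> i; rewrite !ffunE scale1r. Qed.

Lemma dsum_scaleDr : right_distributive dsum_scale +%R.
Proof. by move=> a x y; apply/ffunP=> i; rewrite !ffunE scalerDr. Qed.

Lemma dsum_scaleDl x : {morph dsum_scale^~ x : a b / a + b}.
Proof. by move=> a b; apply/ffunP=> i; rewrite !ffunE scalerDl. Qed.

HB.instance Definition _ := GRing.Zmodule_isLmodule.Build k dsum
  dsum_scaleA dsum_scale1 dsum_scaleDr dsum_scaleDl.

Lemma dsumDE (x y : dsum) i : (x + y) i = x i + y i.
Proof. exact: ffunE. Qed.

Lemma dsumZE a (x : dsum) i : (a *: x) i = a *: x i.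
Proof. exact: ffunE. Qed.

End DirectSum.

Record opmod (k : fieldType) (C : treeCat) := OpMod {
  ob :> C -> lmodType k;
  act : forall X Y : C, hom X Y -> {linear ob Y -> ob X};
  act_id : forall (X : C) x, act (hom_id X) x = x;
  act_comp : forall (X Y Z : C) (g : hom Y Z) (f : hom X Y) x,
    act (hom_comp g f) x = act f (act g x)
}.
Arguments act {k C} M {X Y} f : rename.

Definition opmod_iso (k : fieldType) (C : treeCat) (M N : opmod k C) : Prop :=
  exists f : forall X : C, {linear M X -> N X},
    (forall (X Y : C) (g : hom X Y) x, f X (act M g x) = act N g (f Y x)) /\
    (forall X : C, bijective (f X)).

(* Membership is boolean, as for all the library's submodules; classically
   every submodule is of this form. *)
Record subopmod (k : fieldType) (C : treeCat) (M : opmod k C) := SubOpMod {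
  smem :> forall X : C, submodClosed (M X);
  smem_act : forall (X Y : C) (f : hom X Y) x,
    x \in smem Y -> act M f x \in smem X
}.

Section SubModule.

Variables (k : fieldType) (C : treeCat) (M : opmod k C) (A : subopmod M).

Record sub_ob (X : C) : Type := SubOb { sub_val :> M X; _ : sub_val \in A X }.
HB.instance Definition _ X := [isSub for @sub_val X].
HB.instance Definition _ X := [Choice of sub_ob X by <:].
HB.instance Definition _ X := [SubChoice_isSubLmodule of sub_ob X by <:].

Definition sub_act_fun X Y (f : hom X Y) (x : sub_ob Y) : sub_ob X :=
  SubOb (smem_act f (valP x)).

Lemma sub_act_linear X Y (f : hom X Y) : linear (sub_act_fun f).
Proof. by move=> a x y; apply/val_inj; rewrite /= !linearP. Qed.

HB.instance Definition _ X Y f :=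
  GRing.isLinear.Build k (sub_ob Y) (sub_ob X) _ (sub_act_fun f)
    (@sub_act_linear X Y f).

Definition sub_mod : opmod k C.
Proof.
refine (@OpMod k C (fun X => sub_ob X : lmodType k)
          (fun X Y f => sub_act_fun f : {linear _ -> _}) _ _).
- by move=> X x; apply/val_inj; rewrite /= act_id.
- by move=> X Y Z g f x; apply/val_inj; rewrite /= act_comp.
Defined.

End SubModule.

Section QuotModule.

Variables (k : fieldType) (C : treeCat) (M : opmod k C) (A : subopmod M).

Definition quot_act_fun X Y (f : hom X Y) (q : lquot (A Y)) : lquot (A X) :=
  lpi (A X) (act M f (lrepr q)).

Lemma quot_act_pi X Y (f : hom X Y) x :
  quot_act_fun f (lpi (A Y) x) = lpi (A X) (act M f x).
Proof. by apply/lpi_eq; rewrite -linearB smem_act ?lrepr_sub. Qed.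

Lemma quot_act_linear X Y (f : hom X Y) : linear (quot_act_fun f).
Proof.
move=> a x y; rewrite -[x]lreprK -[y]lreprK -linearP !quot_act_pi.
by rewrite -linearP; congr (lpi _ _); rewrite linearP.
Qed.

HB.instance Definition _ X Y f :=
  GRing.isLinear.Build k (lquot (A Y)) (lquot (A X)) _ (quot_act_fun f)
    (@quot_act_linear X Y f).

Definition quot_mod : opmod k C.
Proof.
refine (@OpMod k C (fun X => lquot (A X) : lmodType k)
          (fun X Y f => quot_act_fun f : {linear _ -> _}) _ _).
- by move=> X x; rewrite -[x]lreprK /= quot_act_pi act_id.
- by move=> X Y Z g f x; rewrite -[x]lreprK /= !quot_act_pi act_comp.
Defined.

End QuotModule.

Section DsumModule.

Variables (k : fieldType) (C : treeCat) (I : finType) (M : I -> opmod k C).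

Definition dsum_act_fun X Y (f : hom X Y) (x : dsum (fun i => M i Y)) :
  dsum (fun i => M i X) := [ffun i => act (M i) f (x i)].

Lemma dsum_act_linear X Y (f : hom X Y) : linear (dsum_act_fun f).
Proof.
move=> a x y; apply/ffunP=> i.
have -> : dsum_act_fun f (a *: x + y) i = act (M i) f (a *: x i + y i).
  by rewrite [LHS]ffunE; congr (act _ _ _); rewrite [LHS]ffunE [X in X + _]ffunE.
rewrite linearP; symmetry; rewrite [LHS]ffunE [X in X + _]ffunE.
by rewrite [dsum_act_fun f x i]ffunE [dsum_act_fun f y i]ffunE.
Qed.

HB.instance Definition _ X Y f :=
  GRing.isLinear.Build k (dsum (fun i => M i Y)) (dsum (fun i => M i X)) _
    (dsum_act_fun f) (@dsum_act_linear X Y f).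

Definition dsum_mod : opmod k C.
Proof.
refine (@OpMod k C (fun X => dsum (fun i => M i X) : lmodType k)
          (fun X Y f => dsum_act_fun f : {linear _ -> _}) _ _).
- by move=> X x; apply/ffunP=> i; rewrite !ffunE act_id.
- by move=> X Y Z g f x; apply/ffunP=> i; rewrite !ffunE act_comp.
Defined.

End DsumModule.

Section Principal.

Variables (k : fieldType) (C : treeCat) (S : C).

(* The free module on the finite set [hom X S] is [{ffun hom X S -> k}], with
   basis the indicator functions; [f : hom X Y] sends the basis vector of
   [phi : hom Y S] to that of [hom_comp phi f]. *)
Definition proj_act_fun X Y (f : hom X Y) (x : {ffun hom Y S -> k^o}) :
    {ffun hom X S -> k^o} :=
  [ffun psi => \sum_(phi | hom_comp phi f == psi) x phi].

Lemma proj_act_linear X Y (f : hom X Y) : linear (proj_act_fun f).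
Proof.
move=> a x y; apply/ffunP=> psi; rewrite !ffunE scaler_sumr -big_split /=.
by apply: eq_bigr => phi _; rewrite !ffunE.
Qed.

HB.instance Definition _ X Y f :=
  GRing.isLinear.Build k {ffun hom Y S -> k^o} {ffun hom X S -> k^o} _
    (proj_act_fun f) (@proj_act_linear X Y f).

Definition proj_mod : opmod k C.
Proof.
refine (@OpMod k C (fun X => {ffun hom X S -> k^o} : lmodType k)
          (fun X Y f => proj_act_fun f : {linear _ -> _}) _ _).
- move=> X x; apply/ffunP=> psi; rewrite ffunE /=.
  by rewrite (big_pred1 psi) // => phi; rewrite hom_comp1.
- move=> X Y Z g f x; apply/ffunP=> psi; rewrite !ffunE /=.
  under [RHS]eq_bigr do rewrite ffunE.
  rewrite (exchange_big_dep (fun phi => hom_comp phi (hom_comp g f) == psi)) /=.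
    apply: eq_bigr => phi /eqP Hphi.
    rewrite (big_pred1 (hom_comp phi g)) // => chi /=.
    rewrite -(eq_sym (hom_comp phi g)).
    case: (eqVneq (hom_comp phi g) chi) => [<-|]; last by rewrite andbF.
    by rewrite -hom_compA Hphi eqxx.
  by move=> chi phi /eqP <- /eqP <-; rewrite hom_compA.
Defined.

End Principal.
Arguments proj_mod k {C} S.

Section Smallness.

Variables (k : fieldType) (C : treeCat).

Definition generated_in_degrees (d : nat) (M : opmod k C) : Prop :=
  exists (n : nat) (S : 'I_n -> C),
    (forall i, (num_edges (utree (S i)) <= d)%N) /\
    exists K : subopmod (dsum_mod (fun i => proj_mod k (S i))),
      opmod_iso M (quot_mod K).

Definition small (d : nat) (M : opmod k C) : Prop :=
  exists G : opmod k C, generated_in_degrees d G /\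
    exists (A : subopmod G) (B : subopmod (sub_mod A)),
      opmod_iso M (quot_mod B).

End Smallness.

Section Filtration.

Variables (k : fieldType) (C : treeCat) (M : opmod k C).

(* [A :&: B], as a submodule of [B]. *)
Section Restrict.

Variables A B : subopmod M.

Definition restrict_pred X : {pred sub_mod B X} :=
  [pred x : sub_ob B X | sub_val x \in A X].
Arguments restrict_pred : clear implicits.

Lemma restrict_closed X : submod_closed (restrict_pred X).
Proof.
split=> [|a x y]; rewrite !inE /= ?rpred0 // => Ax Ay.
by rewrite rpredD ?rpredZ.
Qed.

HB.instance Definition _ X :=
  GRing.isSubmodClosed.Build k (sub_mod B X) (restrict_pred X) (restrict_closed X).

Lemma restrict_act X Y (f : hom X Y) x :
  x \in restrict_pred Y -> act (sub_mod B) f x \in restrict_pred X.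
Proof. by rewrite !inE; apply: smem_act. Qed.

Definition restrict : subopmod (sub_mod B) :=
  @SubOpMod k C (sub_mod B) (fun X => restrict_pred X : submodClosed _)
    restrict_act.

End Restrict.

(* Only the values of [F] at [0, ..., n] matter. *)
Definition is_filtration (n : nat) (F : nat -> subopmod M) : Prop :=
  [/\ forall X x, (x \in F 0%N X) = (x == 0),
      forall X x, x \in F n X &
      forall i, (i < n)%N -> forall X x, x \in F i X -> x \in F i.+1 X].

Definition assoc_graded (n : nat) (F : nat -> subopmod M) : opmod k C :=
  dsum_mod (fun i : 'I_n => quot_mod (restrict (F i) (F i.+1))).

Definition smallish (d : nat) : Prop :=
  exists (n : nat) (F : nat -> subopmod M),
    is_filtration n F /\ small d (assoc_graded n F).

End Filtration.

(* A tuple of directed edges, no two of which are the same edge of [T], even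
   up to orientation. *)
Record edge_tuple (T : tree) (r : nat) := EdgeTuple {
  src : 'I_r -> T;
  tgt : 'I_r -> T;
  edge_adj : forall i, adj (src i) (tgt i);
  edge_inj : injective (fun i => [set src i; tgt i])
}.

Section Subdivision.

Variables (T : tree) (r : nat) (e : edge_tuple T r) (m : 'I_r -> nat).

(* [T(e, m)] is obtained from the vertices of [T] and, for each [i], a path
   with vertices [0, ..., m i], by gluing the ends of the path to [src e i] and
   [tgt e i] and dropping the edge [e i]. If [m i = 0], both ends of [e i] are
   glued to the single vertex of the path, i.e. [e i] is contracted. *)
Definition pre_sub : finType := (T + {i : 'I_r & 'I_(m i).+1})%type.

Definition glue : rel pre_sub := fun u v =>
  match u, v with
  | inl x, inr p =>
      (x == src e (tag p)) && (tagged p == 0%N :> nat)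
      || (x == tgt e (tag p)) && (tagged p == m (tag p) :> nat)
  | _, _ => false
  end.

Definition glued : rel pre_sub := connect [rel u v | glue u v || glue v u].

Lemma glued_refl : reflexive glued. Proof. exact: connect0. Qed.

Lemma glued_sym : symmetric glued.
Proof. by apply: sym_connect_sym => u v /=; rewrite orbC. Qed.

Lemma glued_trans : transitive glued.
Proof. exact: connect_trans. Qed.

Canonical glued_equiv := EquivRel glued glued_refl glued_sym glued_trans.

Definition sub_vert : Type := {eq_quot glued_equiv}.
HB.instance Definition _ := EqQuotient.on sub_vert.
HB.instance Definition _ := Countable.copy sub_vert (can_type (@reprK _ sub_vert)).
HB.instance Definition _ : isFinite sub_vert := CanIsFinite (@reprK _ sub_vert).

Definition subpi (u : pre_sub) : sub_vert := \pi_({eq_quot glued_equiv})%qT u.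

Definition pre_adj : rel pre_sub := fun u v =>
  match u, v with
  | inl x, inl y =>
      adj x y && [forall i, [set x; y] != [set src e i; tgt e i]]
  | inr p, inr q =>
      (tag p == tag q) &&
      (((tagged p).+1 == tagged q :> nat) || ((tagged q).+1 == tagged p :> nat))
  | _, _ => false
  end.

Definition sub_adj : rel sub_vert := fun x y =>
  [exists u, exists v, [&& subpi u == x, subpi v == y & pre_adj u v]].

Lemma pre_adj_sym : symmetric pre_adj.
Proof.
move=> [x|p] [y|q] //=; first by rewrite adj_sym setUC.
by rewrite eq_sym orbC.
Qed.

Lemma sub_adjP x y : reflect (exists u v, [/\ subpi u = x, subpi v = y & pre_adj u v])
  (sub_adj x y).
Proof.
apply: (iffP existsP) => [[u /existsP[v /and3P[/eqP ux /eqP vy uv]]]|].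
  by exists u, v.
by case=> u [v [ux vy uv]]; exists u; apply/existsP; exists v; rewrite ux vy !eqxx.
Qed.

Lemma subpi_onto x : exists u, subpi u = x.
Proof. by exists (repr x); apply: reprK. Qed.

Lemma subpi_glue u v : glue u v -> subpi u = subpi v.
Proof. by move=> uv; apply/eqmodP; apply: connect1; rewrite /= uv. Qed.

Lemma compat_subpi (C : pre_sub -> bool) :
    (forall u v, glue u v -> C u = C v) ->
  forall u v, subpi u = subpi v -> C u = C v.
Proof.
move=> CE u v /eqmodP/connectP[p]; elim: p u => [|w p IHp] u /=; first by move=> _ ->.
case/andP=> uw pw ev; rewrite -(IHp w pw ev).
by case/orP: uw => /CE.
Qed.

Lemma sub_adj_sym : symmetric sub_adj.
Proof.
by move=> x y; apply/sub_adjP/sub_adjP => -[u [v [ux vy uv]]];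
  exists v, u; rewrite pre_adj_sym.
Qed.

(* [C] descends to a cut of the glued graph. *)
Definition precut (u v : pre_sub) (C : pre_sub -> bool) : Prop :=
  [/\ forall u' v', glue u' v' -> C u' = C v', cut pre_adj C u v &
      exists2 t : T, leaf t & C (inl t)].

Lemma edge_cut_inj (c : pred T) i j x y :
    [set x; y] = [set src e i; tgt e i] -> cut (@adj T) c x y -> i != j ->
  c (src e j) = c (tgt e j).
Proof.
move=> exy [_ _ cc] ij; have eE := edge_adj e j.
case cs: (c (src e j)); case ct: (c (tgt e j)) => //.
- have [] := cc _ _ eE cs (negbT ct); move=> e1 e2.
  by case/eqP: ij; apply: (@edge_inj _ _ e); rewrite /= -exy e1 e2.
- have [] := cc _ _ _ ct (negbT cs); first by rewrite adj_sym.
  by move=> e1 e2; case/eqP: ij; apply: (@edge_inj _ _ e); rewrite /= -exy -e1 -e2 setUC.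
Qed.

Lemma precut_inl x y : pre_adj (inl x) (inl y) -> exists C, precut (inl x) (inl y) C.
Proof.
move=> /= /andP[exy /forallP ne]; have [c cC] := tree_cut exy.
have [cx cy cc] := cC.
have cE i : c (src e i) = c (tgt e i).
  have eE := edge_adj e i.
  case cs: (c (src e i)); case ct: (c (tgt e i)) => //.
  - have [] := cc _ _ eE cs (negbT ct); move=> e1 e2.
    by have := ne i; rewrite e1 e2 eqxx.
  - have [] := cc _ _ _ ct (negbT cs); first by rewrite adj_sym.
    by move=> e1 e2; have := ne i; rewrite e1 e2 setUC eqxx.
exists (fun u => match u with inl z => c z | inr p => c (src e (tag p)) end).
split.
- by move=> [z|p] [w|q] //= /orP[] /andP[/eqP-> _].
- split=> // -[z|p] [w|q] //=.
    by case/andP=> ezw _ cz cw; have [-> ->] := cc _ _ ezw cz cw.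
  by case/andP=> /eqP epq _; rewrite epq => ->.
- exact: cut_leaf cC.
Qed.

Lemma precut_sym u v C (t : T) :
  leaf t -> ~~ C (inl t) -> precut u v C -> precut v u (predC C).
Proof.
move=> lt Ct [C1 C2 _]; split; last by exists t.
- by move=> u' v' /C1 /= ->.
- exact: cut_sym pre_adj_sym C2.
Qed.

Lemma precut_inr (p q : {i : 'I_r & 'I_(m i).+1}) :
    tag p = tag q -> (tagged p).+1 = tagged q :> nat ->
  exists2 C, precut (inr p) (inr q) C & exists2 t : T, leaf t & ~~ C (inl t).
Proof.
move=> epq lpq; set i := tag p in epq *.
have [c cC] := tree_cut (edge_adj e i); have [cx cy cc] := cC.
have cE j : i != j -> c (src e j) = c (tgt e j).
  by move=> ij; apply: edge_cut_inj cC ij.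
pose C (u : pre_sub) := match u with inl z => c z | inr s =>
  if tag s == i then (tagged s <= tagged p)%N else c (src e (tag s)) end.
have jm : (tagged p < m i)%N.
  by have := ltn_ord (tagged q); rewrite -lpq ltnS -epq.
exists C; last first.
  have := cut_leaf _ (cut_sym (@adj_sym T) cC).
  by apply; rewrite adj_sym edge_adj.
split; last exact: cut_leaf (edge_adj e i) cC.
- move=> [z|s] [w|s'] //=; case: (eqVneq (tag s') i) => [es|ns].
    case/orP=> /andP[/eqP-> /eqP->]; rewrite es ?cx ?leq0n //.
    by rewrite leqNgt jm (negbTE cy).
  by case/orP=> /andP[/eqP-> _] //; rewrite cE // eq_sym.
- split; rewrite /C; first by rewrite eqxx leqnn.
    have -> : tag q == i by rewrite -epq.
    by rewrite -lpq ltnn.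
  move=> [z|s] [w|s'] //=.
    case/andP=> ezw /forallP/(_ i) ne cz cw.
    by have [e1 e2] := cc _ _ ezw cz cw; rewrite e1 e2 eqxx in ne.
  case/andP=> /eqP ess' nss'.
  have -> : (tag s' == i) = (tag s == i) by rewrite ess'.
  have -> : c (src e (tag s')) = c (src e (tag s)) by rewrite ess'.
  case: (eqVneq (tag s) i) => [es|_ ->] //.
  rewrite -ltnNge => le1 lt2.
  have [v1 v2] : (tagged s = tagged p :> nat) /\ (tagged s' = tagged q :> nat).
    rewrite -lpq; case/orP: nss' => /eqP nss'.
      have es_p : tagged s = tagged p :> nat.
        by apply/eqP; rewrite eqn_leq le1 -ltnS nss'.
      by rewrite -nss' es_p.
    by move: le1; rewrite -nss' leqNgt ltnS ltnW.
  have inj_tag (a b : {i : 'I_r & 'I_(m i).+1}) :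
      tag a = tag b -> tagged a = tagged b :> nat -> a = b.
    case: a b => [a x] [b y] /= eab; rewrite -{b}eab in y * => exy.
    by congr existT; apply: val_inj.
  by split; congr inr; apply: inj_tag; rewrite // -?ess' -?epq.
Qed.

Lemma precut_ex u v : pre_adj u v -> exists C, precut u v C.
Proof.
case: u v => [x|p] [y|q] //=; first exact: precut_inl.
case/andP=> /eqP epq /orP[] /eqP E.
  by have [C HC _] := precut_inr epq E; exists C.
have [C HC [t lt Ct]] := precut_inr (esym epq) E.
by exists (predC C); apply: precut_sym lt Ct HC.
Qed.

Lemma sub_cut x y : sub_adj x y ->
  exists C u v, [/\ precut u v C, subpi u = x, subpi v = y &
     cut sub_adj (fun z => C (repr z)) x y].
Proof.
case/sub_adjP=> u [v [<- <- uv]]; have [C HC] := precut_ex uv.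
exists C, u, v; split=> //; have [C1 [Cu Cv Cc] _] := HC.
have CE w : C (repr (subpi w)) = C w.
  by apply: (compat_subpi C1); apply: reprK.
split; rewrite ?CE // => z w /sub_adjP[u' [v' [<- <- uv']]].
by rewrite !CE => Cu' Cv'; have [-> ->] := Cc _ _ uv' Cu' Cv'.
Qed.

Lemma sub_adj_irr : irreflexive sub_adj.
Proof.
move=> x; case xx: (sub_adj x x) => //.
by have [C [_ [_ [_ _ _ [/= -> //]]]]] := sub_cut xx.
Qed.

Lemma sub_nonempty : (0 < #|{: sub_vert}|)%N.
Proof.
have /card_gt0P[x _] := tree_nonempty T.
by apply/card_gt0P; exists (subpi (inl x)).
Qed.

Lemma sub_path_connect i (j : 'I_(m i).+1) :
  connect sub_adj (subpi (inl (src e i)))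
    (subpi (inr (Tagged (fun i => 'I_(m i).+1) j))).
Proof.
case: j => j; elim: j => [|j IHj] lj.
  suff -> : subpi (inl (src e i)) =
     subpi (inr (Tagged (fun i => 'I_(m i).+1) (Ordinal lj))) by exact: connect0.
  by apply: subpi_glue; rewrite /= !eqxx.
apply: connect_trans (IHj (ltnW lj)) _; apply: connect1; apply/sub_adjP.
by do 2!eexists; split; [reflexivity|reflexivity|]; rewrite /= !eqxx.
Qed.

Lemma sub_connect_inl x y :
  connect sub_adj (subpi (inl x)) (subpi (inl y)).
Proof.
have csym := sym_connect_sym sub_adj_sym.
have /connectP[p] := tree_connected x y.
elim: p x => [|z p IHp] x /=; first by move=> _ ->; apply: connect0.
case/andP=> exz pz ey; apply: connect_trans (IHp z pz ey).
have [ne|] := boolP [forall i, [set x; z] != [set src e i; tgt e i]].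
  apply: connect1; apply/sub_adjP; exists (inl x), (inl z); split=> //=.
  by rewrite exz.
rewrite negb_forall => /existsP[i]; rewrite negbK => /eqP exi.
have ci : connect sub_adj (subpi (inl (src e i))) (subpi (inl (tgt e i))).
  have := sub_path_connect (@ord_max (m i)); congr connect.
  by apply/esym/subpi_glue; rewrite /= !eqxx orbT.
have xz : x != z by apply/eqP=> xz; rewrite xz adj_irr in exz.
have : x \in [set src e i; tgt e i] by rewrite -exi set21.
have : z \in [set src e i; tgt e i] by rewrite -exi set22.
rewrite !inE => /orP[] /eqP ez /orP[] /eqP ex; move: xz; rewrite ex ez ?eqxx //.
by rewrite csym.
Qed.

Lemma sub_connected x y : connect sub_adj x y.
Proof.
have csym := sym_connect_sym sub_adj_sym.
have toT z : exists t : T, connect sub_adj (subpi (inl t)) z.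
  have [[t|[i j]] <-] := subpi_onto z; first by exists t.
  by exists (src e i); apply: sub_path_connect.
have [t xt] := toT x; have [t' yt'] := toT y.
rewrite csym in xt; apply: connect_trans xt _; apply: connect_trans yt'.
exact: sub_connect_inl.
Qed.

Lemma sub_acyclic (c : seq sub_vert) : ucycle sub_adj c -> (size c <= 2)%N.
Proof.
apply: cut_acyclic sub_adj_sym _ c => x y /sub_cut[C [_ [_ [_ _ _ cC]]]].
by exists (fun z => C (repr z)).
Qed.

Definition subdiv : tree :=
  Tree sub_adj_sym sub_adj_irr sub_nonempty sub_connected sub_acyclic.

Definition subdiv_image (x : T) : subdiv := subpi (inl x).

Lemma subdiv_leaf (q : subdiv) : leaf q -> exists2 t : T, leaf t & subdiv_image t = q.
Proof.
rewrite /leaf /degree => /cards1P[q' Nq].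
have adjq z : sub_adj q z = (z == q').
  by have := in_set1 z q'; rewrite -Nq inE.
have [C [u [v [[C1 _ [t lt Ct]] uq vq' [cq cq' cc]]]]] :
    exists C u v, [/\ precut u v C, subpi u = q, subpi v = q' &
     cut sub_adj (fun z => C (repr z)) q q'].
  by apply: sub_cut; rewrite adjq.
exists t => //; set w := subdiv_image t.
have cw : C (repr w).
  by rewrite (compat_subpi C1 (_ : subpi _ = subpi (inl t))) //; apply: reprK.
apply/eqP; apply: contraT => wq.
have [||a [b [ab /= aq]]] :=
    connect_cross (P := fun z => ~~ ((z != q) && C (repr z))) (sub_connected q w).
- by rewrite /= eqxx.
- by rewrite /= wq cw.
rewrite negbK => /andP[bq cb].
move: aq; rewrite negb_and negbK; case: (eqVneq a q) => [eaq _|_ /= ca].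
  move: ab cb; rewrite eaq adjq => /eqP->.
  by rewrite (negbTE cq').
have [|eb _] := cc b a _ cb ca; first by rewrite sub_adj_sym.
by rewrite eb eqxx in bq.
Qed.

Lemma num_leaves_subdiv : (num_leaves subdiv <= num_leaves T)%N.
Proof.
apply: leq_trans (leq_imset_card subdiv_image [set x : T | leaf x]).
apply/subset_leq_card/subsetP=> q; rewrite inE => /subdiv_leaf[t lt <-].
by apply: imset_f; rewrite inE.
Qed.

End Subdivision.

Definition subdiv_rt (T : rtree) (r : nat) (e : edge_tuple T r)
    (m : 'I_r -> nat) : rtree :=
  @RTree (subdiv e m) (subdiv_image e m (root T)).

Definition subdiv_tl (l : nat) (T : cat_Tl l) (r : nat)
    (e : edge_tuple (utree T) r) (m : 'I_r -> nat) : cat_Tl l :=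
  exist _ (subdiv e m) (leq_trans (num_leaves_subdiv e m) (proj2_sig T)).

Section Sprouting.

Variables (T : tree) (r : nat) (v : 'I_r -> T) (m : 'I_r -> nat).

Definition sprout_vert : finType := (T + {i : 'I_r & 'I_(m i)})%type.

Definition sprout_adj : rel sprout_vert := fun x y =>
  match x, y with
  | inl a, inl b => adj a b
  | inl a, inr p => a == v (tag p)
  | inr p, inl a => a == v (tag p)
  | inr _, inr _ => false
  end.

Lemma sprout_adj_sym : symmetric sprout_adj.
Proof. by move=> [x|p] [y|q] //=; rewrite adj_sym. Qed.

Lemma sprout_adj_irr : irreflexive sprout_adj.
Proof. by move=> [x|p] //=; rewrite adj_irr. Qed.

Lemma sprout_nonempty : (0 < #|sprout_vert|)%N.
Proof.
have /card_gt0P[x _] := tree_nonempty T.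
by apply/card_gt0P; exists (inl x).
Qed.

Lemma sprout_connected x y : connect sprout_adj x y.
Proof.
have csym := sym_connect_sym sprout_adj_sym.
have toT z : exists t : T, connect sprout_adj (inl t) z.
  case: z => [t|p]; first by exists t.
  by exists (v (tag p)); apply: connect1; rewrite /= eqxx.
have [t xt] := toT x; have [t' yt'] := toT y.
rewrite csym in xt; apply: connect_trans xt _; apply: connect_trans yt'.
have /connectP[p] := tree_connected t t'.
elim: p t => [|z p IHp] t /=; first by move=> _ ->; apply: connect0.
case/andP=> tz pz et'; apply: connect_trans (IHp z pz et').
exact: connect1.
Qed.

Lemma sprout_acyclic (c : seq sprout_vert) :
  ucycle sprout_adj c -> (size c <= 2)%N.
Proof.
apply: cut_acyclic sprout_adj_sym _ c.
have new p : cut sprout_adj (pred1 (inr p)) (inr p) (inl (v (tag p))).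
  split=> //=.
  move=> u w uw /eqP eu _; rewrite eu in uw *; split=> //.
  by case: w uw => //= a /eqP->.
move=> [a|p] [b|q] //=.
- move=> ab; have [c [ca cb cc]] := tree_cut ab.
  exists (fun u => match u with inl z => c z | inr p => c (v (tag p)) end).
  split=> // -[z|p] [w|q] //=.
  + by move=> zw cz cw; have [-> ->] := cc _ _ zw cz cw.
  + by move/eqP->=> ->.
  + by move/eqP->=> ->.
- move/eqP->; exists (predC (pred1 (inr q))).
  exact: cut_sym sprout_adj_sym (new q).
- by move/eqP->; exists (pred1 (inr p)); apply: new.
Qed.

Definition sprout : tree :=
  Tree sprout_adj_sym sprout_adj_irr sprout_nonempty sprout_connected
    sprout_acyclic.

End Sprouting.

Definition sprout_rt (T : rtree) (r : nat) (v : 'I_r -> T)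
    (m : 'I_r -> nat) : rtree :=
  @RTree (sprout v m) (inl (root T)).

(* [V] has dimension [n] over [k]: [V] is linearly isomorphic to [k ^ n]. *)
Definition has_dim (k : fieldType) (V : lmodType k) (n : nat) : Prop :=
  inhabited (Vector.axiom n V).

(* The coefficients are rational, as such counting polynomials are in general
   not integral; [msize f] is the total degree plus one ([0] if [f = 0]). *)
Definition eventually_poly (k : fieldType) (d r : nat)
    (V : ('I_r -> nat) -> lmodType k) : Prop :=
  exists f : {mpoly rat[r]}, (msize f <= d.+1)%N /\
    exists N : nat, forall m : 'I_r -> nat, (forall i, (N <= m i)%N) ->
      exists2 n : nat, has_dim (V m) n & n%:R = f.@[fun i => (m i)%:R].

(* Main.v *)
Require Import Defs.
From mathcomp Require Import mpoly.
From mathcomp Require Import all_boot all_order all_algebra.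
From HB Require Import structures.
From mathcomp Require Import boolp zify.

(**
Write [X m] for the tree obtained from [T] by subdividing or sprouting.  A
contraction [X m -> S] is determined by its values on the vertices of [T] and
by one word of length [m i] for each [i]: a letter of the word is [None] when
the corresponding new edge is contracted, and otherwise records the image of
the far end of that edge.  Since uncontracted edges inject into the edges of
[S], such a contraction has at most [num_edges S <= d] letters other than
[None] in total.  Contracting one new edge gives a contraction
[X (incr m i) -> X m], and composing with it inserts [None] at a fixed place
of the [i]-th word.

Order the contractions lexicographically by their words.  Insertion at a fixed
place preserves the order, so the leading terms of a submodule of a sum of
principal projectives are stable under inserting [None], and there are as many
of them as the dimension.  Once the letters other than [None] are fixed, a
word is a vector of gap lengths, and the leading terms form an up-set of such
vectors.  By Dickson's lemma this up-set is a finite union of cones, and by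
inclusion-exclusion it is enough to count the vectors of a cone with given
sum in each block.  This number is a product of binomial coefficients, of
degree one less than the number of gaps in each block, hence of total degree
at most [d].  The dimension of a smallish module is that of its associated
graded module, a difference of the dimensions of two such submodules.
*)

Set Implicit Arguments.
Unset Strict Implicit.
Unset Printing Implicit Defensive.

(** * Eventually polynomial families of numbers *)

Section EventualPolynomials.

Import GRing.Theory.
Local Open Scope ring_scope.

Variable r : nat.
Implicit Types (d : nat) (m : 'I_r -> nat) (Q : ('I_r -> nat) -> nat -> Prop).

(** A relation [Q m n] instead of a function, because dimensions and cardinalities are only
    available through propositions such as [has_dim] and [has_card]. By conversion [eventually_poly]
    is the case [Q m n := has_dim (V m) n]. *)
Definition ev_poly d Q : Prop :=
  exists f : {mpoly rat[r]}, (msize f <= d.+1)%N /\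
    exists N : nat, forall m, (forall i, (N <= m i)%N) ->
      exists2 n : nat, Q m n & n%:R = f.@[fun i => (m i)%:R].

Lemma ev_poly_eventually d N Q Q' :
    (forall m n, (forall i, (N <= m i)%N) -> Q m n -> Q' m n) ->
  ev_poly d Q -> ev_poly d Q'.
Proof.
move=> QQ' [f [df [N' Nf]]]; exists f; split=> //; exists (maxn N N') => m mN.
have [i|n Qn fn] := Nf m; first by apply: leq_trans (mN i); apply: leq_maxr.
by exists n => //; apply: QQ' => // i; apply: leq_trans (mN i); apply: leq_maxl.
Qed.

Lemma ev_poly_sub_imp d Q Q' :
  (forall m n, Q m n -> Q' m n) -> ev_poly d Q -> ev_poly d Q'.
Proof. by move=> QQ'; apply: (@ev_poly_eventually _ 0) => m n _; apply: QQ'. Qed.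

Lemma ev_poly_const d c : ev_poly d (fun _ n => n = c).
Proof.
exists (c%:R)%:MP_[r]; split; first by rewrite msizeC; case: eqP.
by exists 0%N => m _; exists c => //; rewrite mevalC.
Qed.

Lemma msizeB_le (R : nzRingType) n (p q : {mpoly R[n]}) d :
  (msize p <= d -> msize q <= d -> msize (p - q) <= d)%N.
Proof.
move=> pd qd; apply: leq_trans (mmeasureD_le _ _ _) _.
by rewrite geq_max pd mmeasureN.
Qed.

(** The difference is stated as [c + b = a], so no truncated subtraction has to be cast to [rat]. *)
Lemma ev_poly_diff d Q1 Q2 Q :
    (forall m a b, Q1 m a -> Q2 m b -> exists2 c, Q m c & (c + b)%N = a) ->
  ev_poly d Q1 -> ev_poly d Q2 -> ev_poly d Q.
Proof.
move=> H [f1 [d1 [N1 F1]]] [f2 [d2 [N2 F2]]].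
exists (f1 - f2); split; first exact: msizeB_le.
exists (maxn N1 N2) => m mN.
have [i|a Qa fa] := F1 m; first by apply: leq_trans (mN i); apply: leq_maxl.
have [i|b Qb fb] := F2 m; first by apply: leq_trans (mN i); apply: leq_maxr.
have [c Qc abc] := H _ _ _ Qa Qb; exists c => //.
by rewrite mevalB -fa -fb -abc natrD addrK.
Qed.

Lemma ev_poly_sum d (I : finType) (P : I -> ('I_r -> nat) -> nat -> Prop) Q :
    (forall m (F : I -> nat), (forall i, P i m (F i)) -> Q m (\sum_i F i)%N) ->
  (forall i, ev_poly d (P i)) -> ev_poly d Q.
Proof.
move=> HQ HP.
have [f Pf] := choice HP.
have [N PN] := choice (fun i => (Pf i).2).
exists (\sum_i f i); split.
  apply: leq_trans (mmeasure_sum _ _ _ _) _; apply/bigmax_leqP => i _.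
  by case: (Pf i).
exists (\max_i N i)%N => m mN.
have /choice[F FP] : forall i, exists n, P i m n /\ n%:R = (f i).@[fun i => (m i)%:R].
  move=> i; have [j|n] := PN i m; last by exists n.
  by apply: leq_trans (mN j); apply: leq_bigmax.
exists (\sum_i F i)%N; first by apply: HQ => i; case: (FP i).
rewrite natr_sum (raddf_sum (meval _)) /=.
by apply: eq_bigr => i _; case: (FP i).
Qed.

Lemma ev_poly_add d Q1 Q2 Q :
    (forall m a b, Q1 m a -> Q2 m b -> Q m (a + b)%N) ->
  ev_poly d Q1 -> ev_poly d Q2 -> ev_poly d Q.
Proof.
move=> H H1 H2; apply: (@ev_poly_sum _ _ (fun b : bool => if b then Q1 else Q2)).
  move=> m F HF; rewrite big_bool /=.
  by apply: H; [have := HF true|have := HF false].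
by case.
Qed.

Lemma ev_poly_leq d d' Q : (d <= d')%N -> ev_poly d Q -> ev_poly d' Q.
Proof. by move=> dd [f [df H]]; exists f; split=> //; apply: leq_trans df _. Qed.

Lemma ev_poly_mul d1 d2 (F1 F2 : ('I_r -> nat) -> nat) :
    ev_poly d1 (fun m n => n = F1 m) -> ev_poly d2 (fun m n => n = F2 m) ->
  ev_poly (d1 + d2) (fun m n => n = (F1 m * F2 m)%N).
Proof.
move=> [f1 [s1 [N1 E1]]] [f2 [s2 [N2 E2]]]; exists (f1 * f2); split.
  have [->|f10] := eqVneq f1 0; first by rewrite mul0r msize0.
  have [->|f20] := eqVneq f2 0; first by rewrite mulr0 msize0.
  (* [msize] is the degree plus one, hence the predecessor; a zero factor, of size 0, was set
     aside. *)
  rewrite msizeM // -subn1 leq_subLR.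
  by apply: leq_trans (leq_add s1 s2) _; lia.
exists (maxn N1 N2) => m mN; exists (F1 m * F2 m)%N => //.
have [i|_ -> fa] := E1 m; first by apply: leq_trans (mN i); apply: leq_maxl.
have [i|_ -> fb] := E2 m; first by apply: leq_trans (mN i); apply: leq_maxr.
by rewrite mevalM natrM fa fb.
Qed.

Lemma ev_poly_prod (I : Type) (s : seq I) (d : I -> nat)
    (F : I -> ('I_r -> nat) -> nat) :
    (forall i, ev_poly (d i) (fun m n => n = F i m)) ->
  ev_poly (\sum_(i <- s) d i) (fun m n => n = \prod_(i <- s) F i m)%N.
Proof.
move=> H; elim: s => [|i s IHs].
  apply: ev_poly_sub_imp (ev_poly_const _ 1%N) => m n ->.
  by rewrite big_nil.
rewrite big_cons; apply: ev_poly_sub_imp (ev_poly_mul (H i) IHs) => m n ->.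
by rewrite big_cons.
Qed.

Lemma ev_poly_shift (i : 'I_r) (a b : nat) :
  ev_poly 1 (fun m n => n = m i - a + b)%N.
Proof.
exists ('X_i + (b%:R - a%:R)%:MP); split.
  apply: leq_trans (mmeasureD_le _ _ _) _.
  by rewrite geq_max msizeX msizeC mdeg1; case: eqP.
exists a => m am; exists (m i - a + b)%N => //.
by rewrite mevalD mevalXU mevalC natrD natrB ?am // addrAC addrA.
Qed.

(** Up to the factor [c!] this is a falling factorial, a product of [c] linear factors. Dividing by
    [c!] is what calls for rational coefficients. *)
Lemma ev_poly_binomial (i : 'I_r) (a c : nat) :
  ev_poly c (fun m n => n = 'C(m i - a + c, c))%N.
Proof.
have [f [df [N Nf]]] : ev_poly c (fun m n => n = (m i - a + c) ^_ c)%N.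
  have := ev_poly_prod (index_enum 'I_c) (fun j => ev_poly_shift i a (c - j)).
  rewrite sum1_card card_ord; apply: ev_poly_sub_imp => m n ->.
  rewrite ffact_prod.
  by apply: eq_bigr => j _; rewrite addnBA // ltnW.
have c0 : (c`!)%:R != 0 :> rat by rewrite Num.Theory.pnatr_eq0 -lt0n fact_gt0.
exists ((c`!)%:R^-1 *: f); split; first by apply: leq_trans (msizeZ_le _ _) _.
exists N => m /Nf[n nE fE]; exists 'C(m i - a + c, c) => //.
by rewrite mevalZ -fE nE -bin_ffact natrM mulrC mulfK.
Qed.

End EventualPolynomials.

(** * Up-sets of exponent vectors *)

Section Counting.

(** The predicates counted are propositions on possibly infinite types, so finiteness is part of the
    notion. *)
Definition has_card (T : eqType) (Q : T -> Prop) (n : nat) : Prop :=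
  exists s : seq T, [/\ uniq s, forall x, x \in s <-> Q x & size s = n].

Lemma has_card_ext (T : eqType) (Q Q' : T -> Prop) n :
  (forall x, Q x <-> Q' x) -> has_card Q n -> has_card Q' n.
Proof. by move=> QQ [s [us sQ sn]]; exists s; split=> // x; rewrite sQ. Qed.

Lemma has_card0 (T : eqType) (Q : T -> Prop) :
  (forall x, ~ Q x) -> has_card Q 0.
Proof. by move=> Q0; exists [::]; split=> // x; split=> // /Q0. Qed.

Lemma has_card_image (T T' : eqType) (f : T -> T') (Q : T -> Prop) n :
    (forall x y, Q x -> Q y -> f x = f y -> x = y) -> has_card Q n ->
  has_card (fun y => exists2 x, Q x & y = f x) n.
Proof.
move=> finj [s [us sQ sn]]; exists (map f s); split; last by rewrite size_map.
- rewrite map_inj_in_uniq // => x y /sQ Qx /sQ Qy; exact: finj.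
- move=> y; split=> [/mapP[x /sQ Qx ->]|[x /sQ xs ->]]; first by exists x.
  exact: map_f.
Qed.

Lemma has_card_unique (T : eqType) (Q : T -> Prop) a b :
  has_card Q a -> has_card Q b -> a = b.
Proof.
move=> [s [us sQ <-]] [s' [us' sQ' <-]]; apply/eqP; rewrite -uniq_size_uniq //.
by move=> x; apply/idP/idP=> [/sQ' ?|/sQ ?]; [apply/sQ|apply/sQ'].
Qed.

(** Finiteness of [Q] has to be produced here: preimages are collected along the enumeration of the
    image, and the size then follows from [has_card_image] and uniqueness. *)
Lemma has_card_preim (T T' : choiceType) (f : T -> T') (Q : T -> Prop) n :
    (forall x y, Q x -> Q y -> f x = f y -> x = y) ->
  has_card (fun y => exists2 x, Q x & y = f x) n -> has_card Q n.
Proof.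
move=> finj [s [us sQ sn]].
suff [t [ut tQ]] : exists t : seq T, uniq t /\ forall x, x \in t <-> Q x.
  have tn : has_card Q (size t) by exists t.
  have := has_card_unique (has_card_image finj tn); move=> /(_ n).
  by move=> <- //; exists s.
have {us sn} : forall y, y \in s -> exists2 x, Q x & y = f x by move=> y /sQ.
have : forall x, Q x -> f x \in s by move=> x Qx; apply/sQ; exists x.
elim: s {sQ} Q finj => [|y s IHs] Q finj fs sf.
  by exists [::]; split=> // x; split=> // /fs.
have [x0 Qx0 yx0] := sf y (mem_head _ _).
case: (IHs (fun x => Q x /\ f x \in s)) => [x x' [Qx _] [Qx' _]|x []|z zs|t [ut tQ]] //.
- exact: finj.
- have [|x Qx zx] := sf z; first by rewrite inE zs orbT.
  by exists x => //; rewrite -zx.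
(* The induction no longer knows that the enumeration is duplicate-free; if [y] occurs again, its
   preimage is already in [t]. *)
have [ys|ys] := boolP (y \in s).
  exists t; split=> // x; rewrite tQ; split=> [[]|Qx] //; split=> //.
  by have := fs _ Qx; rewrite inE => /orP[/eqP->|].
exists (x0 :: t); split=> [|x] /=.
  rewrite ut andbT; apply/negP=> /tQ[_]; by rewrite -yx0 (negbTE ys).
rewrite inE; split=> [/orP[/eqP->|/tQ[]]|Qx] //.
have := fs _ Qx; rewrite inE => /orP[/eqP e|xs].
  by rewrite (finj x x0) ?eqxx // e.
by apply/orP; right; apply/tQ.
Qed.

Lemma has_card_union (T : eqType) (Q1 Q2 : T -> Prop) a b c :
    has_card Q1 a -> has_card Q2 b -> has_card (fun x => Q1 x /\ Q2 x) c ->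
  exists2 n, has_card (fun x => Q1 x \/ Q2 x) n & (n + c = a + b)%N.
Proof.
move=> [s1 [u1 q1 <-]] [s2 [u2 q2 <-]] C.
exists (size (s1 ++ [seq x <- s2 | x \notin s1])).
  exists (s1 ++ [seq x <- s2 | x \notin s1]); split=> // [|x].
    rewrite cat_uniq u1 filter_uniq // andbT.
    by apply/hasPn => x; rewrite mem_filter => /andP[].
  rewrite mem_cat mem_filter -q1 -q2.
  by case: (x \in s1); case: (x \in s2); split=> //; [left|left|right|case].
have -> : c = size [seq x <- s2 | x \in s1].
  apply: has_card_unique C _; exists [seq x <- s2 | x \in s1]; split=> //.
    exact: filter_uniq.
  move=> x; rewrite mem_filter; split=> [/andP[/q1 ? /q2]|[/q1-> /q2]] //.
rewrite size_cat -addnA !size_filter; congr addn.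
by rewrite -(count_predC (fun x => x \in s1) s2) addnC.
Qed.

Lemma has_card_bigunion (T : eqType) (I : eqType) (s : seq I) (Q : I -> T -> Prop)
    (n : I -> nat) :
    uniq s -> (forall i j x, Q i x -> Q j x -> i = j) ->
    (forall i, i \in s -> has_card (Q i) (n i)) ->
  has_card (fun x => exists2 i, i \in s & Q i x) (\sum_(i <- s) n i).
Proof.
move=> us Qd; elim: s us => [|i s IHs] /=.
  by move=> _ _; rewrite big_nil; apply: has_card0 => x [].
move=> /andP[is0 us] H.
have [||k Hk] := has_card_union (H i (mem_head _ _)) (IHs us _) (c := 0).
- by move=> j js; apply: H; rewrite inE js orbT.
- by apply: has_card0 => x [Qi [j js Qj]]; case/negP: is0; rewrite (Qd _ _ _ Qi Qj).
rewrite addn0 big_cons => <-.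
apply: has_card_ext Hk => x; split=> [[Qi|[j js Qj]]|[j]].
- by exists i; rewrite ?mem_head.
- by exists j; rewrite ?inE ?js ?orbT.
- by rewrite inE => /orP[/eqP->|js] Qj; [left|right; exists j].
Qed.

End Counting.

Section UpSets.

Variable E : finType.
Implicit Types (u v s : {ffun E -> nat}) (U : {ffun E -> nat} -> Prop).

Definition vec_le u v : Prop := forall x, u x <= v x.

Definition upd (T : eqType) (u : {ffun E -> T}) x t : {ffun E -> T} :=
  [ffun y => if y == x then t else u y].

(** Dickson's lemma, by induction on a list [l] of coordinates, for up-sets with respect to
    comparison on [l] only. For a new coordinate [x] the slices at height [t] grow with [t]. The
    finitely many generators of their union all lie in the slice at some height [t0]; placed there,
    they serve all heights from [t0] on, and only the [t0] lower slices remain. *)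
Lemma dickson U :
    (forall u v, vec_le u v -> U u -> U v) ->
  exists G : seq {ffun E -> nat}, (forall s, s \in G -> U s) /\
    forall u, U u -> exists2 s, s \in G & vec_le s u.
Proof.
move=> Uup.
suff main (l : seq E) U' :
    (forall u v, {in l, forall x, u x <= v x} -> U' u -> U' v) ->
  exists G : seq {ffun E -> nat}, (forall s, s \in G -> U' s) /\
    forall u, U' u -> exists2 s, s \in G & {in l, forall x, s x <= u x}.
  have [u v uv|G [GU UG]] := main (enum E) U.
    by apply: Uup => x; apply: uv; rewrite mem_enum.
  exists G; split=> // u /UG[s sG su]; exists s => // x.
  by apply: su; rewrite mem_enum.
elim: l U' {U Uup} => [|x l IHl] U Uup.
  (* Comparison on no coordinate always holds, so one element generates everything. *)
  have [[u Uu]|nU] := EM (exists u, U u).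
    exists [:: u]; split=> [s|v Uv]; first by rewrite inE => /eqP->.
    by exists u; rewrite ?mem_head.
  by exists [::]; split=> // u Uu; case: nU; exists u.
have slice_up t u v : {in l, forall y, u y <= v y} -> U (upd u x t) -> U (upd v x t).
  move=> uv; apply: Uup => y; rewrite inE !ffunE; case: eqP => //= _ yl.
  exact: uv.
have slice_mono t t' u : t <= t' -> U (upd u x t) -> U (upd u x t').
  by move=> tt; apply: Uup => y _; rewrite !ffunE; case: eqP.
have [|Goo [GUoo UGoo]] := IHl (fun u => exists t, U (upd u x t)).
  by move=> u v uv [t Ut]; exists t; apply: slice_up Ut.
have [t0 Gt0] : exists t0, forall s, s \in Goo -> U (upd s x t0).
  elim: (Goo) GUoo => [|s G IHG] GU; first by exists 0.
  have [t Ut] := GU s (mem_head _ _).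
  have [s' s'G|t' Ut'] := IHG; first by apply: GU; rewrite inE s'G orbT.
  exists (maxn t t') => s'; rewrite inE => /orP[/eqP->|/Ut'].
    exact: slice_mono (leq_maxl _ _) Ut.
  exact: slice_mono (leq_maxr _ _).
have /choice[G HG] : forall t, exists G : seq {ffun E -> nat},
   (forall s, s \in G -> U (upd s x t)) /\
    forall u, U (upd u x t) -> exists2 s, s \in G & {in l, forall y, s y <= u y}.
  by move=> t; apply: IHl; apply: slice_up.
exists ([seq upd s x t0 | s <- Goo] ++
        flatten [seq [seq upd s x t | s <- G t] | t <- iota 0 t0]).
split=> [s|u Uu].
  rewrite mem_cat => /orP[/mapP[s' /Gt0 ? ->] //|].
  by case/flattenP=> _ /mapP[t _ ->] /mapP[s' s'G ->]; apply: (HG t).1.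
have uE : u = upd u x (u x) by apply/ffunP=> y; rewrite ffunE; case: eqP => [->|].
have le_upd s t : t <= u x -> {in l, forall y, s y <= u y} ->
    {in x :: l, forall y, upd s x t y <= u y}.
  move=> tx su y; rewrite inE ffunE; case: eqP => [->|_] //=; exact: su.
have [lt|le] := ltnP (u x) t0.
  have [|s sG su] := (HG (u x)).2 u; first by rewrite -uE.
  exists (upd s x (u x)); last exact: le_upd.
  rewrite mem_cat; apply/orP; right; apply/flattenP.
  exists [seq upd s x (u x) | s <- G (u x)]; last exact: map_f.
  by apply/mapP; exists (u x); rewrite // mem_iota.
have [|s sG su] := UGoo u; first by exists (u x); rewrite -uE.
exists (upd s x t0); last exact: le_upd.
by rewrite mem_cat (map_f (fun s => upd s x t0)).
Qed.

End UpSets.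

(** * Counting vectors with prescribed sums over blocks *)

Section BlockCount.

Variables (E : finType) (r : nat) (blk : E -> 'I_r).
Implicit Types (u v s : {ffun E -> nat}).

Definition bsum u i := \sum_(x | blk x == i) u x.

(** ['C((n + c).-1, n)] is the number of [c]-tuples of naturals with sum [n], also for [c = 0]
    thanks to the truncated predecessor. The sum runs over the value [t] of one further
    coordinate. *)
Lemma hockey_stick c q : \sum_(t < q.+1) 'C((q - t + c).-1, q - t) = 'C(q + c, q).
Proof.
elim: q => [|q IHq]; first by rewrite big_ord1 !bin0.
by rewrite big_ord_recl /= IHq addSn /= binS.
Qed.

Lemma bsum_upd u x t i : u x = 0 ->
  bsum (upd u x t) i = bsum u i + (if blk x == i then t else 0).
Proof.
move=> ux; rewrite /bsum; case: ifP => bi; last first.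
  rewrite addn0; apply: eq_bigr => y /eqP yi; rewrite ffunE; case: eqP => // yx.
  by rewrite -yi yx eqxx in bi.
rewrite (bigD1 x) //= [in RHS](bigD1 x) //= ffunE eqxx ux add0n addnC.
by congr addn; apply: eq_bigr => y /andP[_ /negbTE yx]; rewrite ffunE yx.
Qed.

(** Stars and bars in every block, by induction on the set [D] of coordinates allowed to be nonzero:
    an element [x] of [D] is removed and the vectors are sorted by their value [t] at [x]. *)
Lemma card_simplex (D : {set E}) (p : 'I_r -> nat) :
  has_card (fun u => (forall x, x \notin D -> u x = 0) /\ forall i, bsum u i = p i)
    (\prod_i 'C((p i + #|[set x in D | blk x == i]|).-1, p i)).
Proof.
elim: {D}#|D| {-2}D (erefl #|D|) p => [|n IHn] D cD p.
  have /eqP D0 : D == set0 by rewrite -cards_eq0 cD.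
  have c0 i : #|[set x in D | blk x == i]| = 0.
    by apply: eq_card0 => x; rewrite !inE D0 inE.
  under eq_bigr do rewrite c0 addn0.
  have [/forallP p0|] := boolP [forall i, p i == 0].
    rewrite big1 => [|i _]; last by rewrite (eqP (p0 i)).
    exists [:: [ffun => 0]]; split=> // u; rewrite inE; split=> [/eqP->|[u0 _]].
      split=> [x|i]; first by rewrite ffunE.
      by rewrite (eqP (p0 i)); apply: big1 => x _; rewrite ffunE.
    by apply/eqP/ffunP=> x; rewrite ffunE u0 // D0 inE.
  rewrite negb_forall => /existsP[i pi0].
  (* With [D] empty a positive sum is impossible, and the factor ['C((p i).-1, p i)] vanishes
     accordingly. *)
  rewrite (bigD1 i) //= bin_small; last by case: (p i) pi0.
  rewrite mul0n; apply: has_card0 => u [u0 ui].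
  case/negP: pi0; rewrite -ui; apply/eqP/big1 => x _.
  by rewrite u0 // D0 inE.
have [x xD] : exists x, x \in D by apply/card_gt0P; rewrite cD.
set i0 := blk x; pose D' := D :\ x.
have cD' : #|D'| = n by move: cD; rewrite (cardsD1 x) xD => -[].
pose q t i := if i0 == i then p i - t else p i.
pose Q (t : nat) u := exists2 v : {ffun E -> nat}, (forall y, y \notin D' -> v y = 0) /\
                          (forall i, bsum v i = q t i) & u = upd v x t.
have Qx t u : Q t u -> u x = t by case=> v _ ->; rewrite ffunE eqxx.
have HQ t : t \in iota 0 (p i0).+1 -> has_card (Q t)
    (\prod_i 'C((q t i + #|[set y in D' | blk y == i]|).-1, q t i)).
  move=> _; apply: has_card_image (IHn _ cD' (q t)) => u v [u0 _] [v0 _] /ffunP uv.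
  apply/ffunP=> y; have := uv y; rewrite !ffunE; case: eqP => // -> _.
  by rewrite u0 ?v0 // setD11.
have := has_card_bigunion (iota_uniq _ _) _ HQ.
have /[swap]/[apply] : forall i j u, Q i u -> Q j u -> i = j.
  by move=> i j u /Qx <- /Qx.
rewrite -[iota _ _]/(index_iota 0 (p i0).+1) big_mkord.
set N := \sum_(t < _) _; suff -> : N = \prod_i 'C((p i + #|[set y in D | blk y == i]|).-1, p i).
  apply: has_card_ext => u; split=> [[t tp [v [v0 vq] ->]]|[u0 up]].
    split=> [y yD|i].
      rewrite ffunE; case: eqP => [yx|_]; first by rewrite yx xD in yD.
      by rewrite v0 // inE negb_and yD orbT.
    rewrite bsum_upd; last by rewrite v0 // setD11.
    rewrite vq /q -/i0; case: eqP => [<-|]; last by rewrite addn0.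
    by rewrite subnK //; rewrite mem_index_iota in tp.
  exists (u x).
    rewrite mem_index_iota /= ltnS -up /bsum (bigD1 x) //=; exact: leq_addr.
  have uE : u = upd (upd u x 0) x (u x).
    by apply/ffunP=> y; rewrite !ffunE; case: eqP => [->|].
  exists (upd u x 0) => //; split=> [y|i].
    by rewrite !inE negb_and negbK ffunE; case: eqP => //= _; apply: u0.
  have := @bsum_upd (upd u x 0) x (u x) i.
  rewrite ffunE eqxx => /(_ erefl); rewrite -uE up => pE.
  rewrite /q -/i0 in pE *; rewrite pE; case: eqP => _; last by rewrite addn0.
  by rewrite addnK.
(* Only the factor of the block [i0] of [x] depends on [t]; the others are taken out of the sum. *)
rewrite /N (bigD1 i0) //=.
transitivity (\sum_(t < (p i0).+1) 'C((p i0 - t + #|[set y in D' | blk y == i0]|).-1, p i0 - t)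
   * \prod_(i | i != i0) 'C((p i + #|[set y in D | blk y == i]|).-1, p i)).
  apply: eq_bigr => t _; rewrite (bigD1 i0) //= /q eqxx; congr muln.
  apply: eq_bigr => i ii0; rewrite eq_sym (negbTE ii0).
  congr ('C((_ + _).-1, _)); apply: eq_card => y; rewrite !inE.
  by case: eqP => //= ->; rewrite -/i0 eq_sym (negbTE ii0) andbF.
rewrite -big_distrl /= hockey_stick; congr muln.
have -> : #|[set y in D | blk y == i0]| = #|[set y in D' | blk y == i0]|.+1.
  rewrite (cardsD1 x) !inE xD eqxx add1n; congr _.+1.
  by apply: eq_card => y; rewrite !inE andbA.
by rewrite addnS.
Qed.

Lemma bsumD u v i : bsum [ffun x => u x + v x] i = bsum u i + bsum v i.
Proof. by rewrite -big_split; apply: eq_bigr => x _; rewrite ffunE. Qed.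

Section Surjective.

Variable c : 'I_r -> nat.
Hypothesis blkE : forall i, #|[set x | blk x == i]| = (c i).+1.

(** Translation by [s] reduces this to [card_simplex] on all coordinates. The binomials are
    rewritten with the constant lower index [c i], which shows that they are polynomial in [p i]. *)
Lemma card_cone s (p : 'I_r -> nat) :
    (forall i, bsum s i <= p i) ->
  has_card (fun u => vec_le s u /\ forall i, bsum u i = p i)
    (\prod_i 'C(p i - bsum s i + c i, c i)).
Proof.
move=> sp; have := card_simplex setT (fun i => p i - bsum s i).
pose f u : {ffun E -> nat} := [ffun x => u x + s x].
have finj : injective f.
  move=> u v /ffunP uv; apply/ffunP=> x; have := uv x; rewrite !ffunE.
  exact: addIn.
move/(has_card_image (f := f)) => /(_ (fun u v _ _ => @finj u v)).
under eq_bigr => i _.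
  have -> : #|[set x in [set: E] | blk x == i]| = (c i).+1.
    by rewrite -blkE; apply: eq_card => x; rewrite !inE.
  rewrite addnS /= -bin_sub ?leq_addr // addKn.
  over.
apply: has_card_ext => u; split=> [[v [_ vp] ->]|[su up]].
  split=> [x|i]; first by rewrite ffunE leq_addl.
  by rewrite bsumD vp subnK.
exists [ffun x => u x - s x]; last by apply/ffunP=> x; rewrite !ffunE subnK.
split=> [x|i]; first by rewrite inE.
rewrite -up; set v := [ffun x => _].
have -> : u = [ffun x => v x + s x] by apply/ffunP=> x; rewrite !ffunE subnK.
by rewrite bsumD addnK.
Qed.

(** In the application [a i] is the number of letters other than [None] of the [i]-th word and [u]
    lists its gap lengths, so that [a i + bsum u i] is its length. *)
Lemma ev_poly_cone (a : 'I_r -> nat) s :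
  ev_poly (\sum_i c i) (fun m n =>
    has_card (fun u => vec_le s u /\ forall i, a i + bsum u i = m i) n).
Proof.
have := ev_poly_prod (index_enum 'I_r)
  (fun i => ev_poly_binomial i (a i + bsum s i) (c i)).
apply: (@ev_poly_eventually _ _ (\max_i (a i + bsum s i))) => m n mN ->.
have am i : a i + bsum s i <= m i by apply: leq_trans (mN i); apply: leq_bigmax.
have sm i : bsum s i <= m i - a i by have := am i; lia.
have := card_cone sm.
under eq_bigr => i _ do rewrite -subnDA.
apply: has_card_ext => u; split=> -[su up]; split=> // i.
  by rewrite up subnKC //; have := am i; lia.
by rewrite -up addKn.
Qed.

(** Inclusion-exclusion: the cone at [s] meets the union of the cones at [G] in the union of the
    cones at the joins of [s] with the elements of [G]. There are as many joins as elements of [G],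
    whence the induction on the size. *)
Lemma ev_poly_up (a : 'I_r -> nat) (G : seq {ffun E -> nat}) :
  ev_poly (\sum_i c i) (fun m n =>
    has_card (fun u => (exists2 s, s \in G & vec_le s u) /\
                       forall i, a i + bsum u i = m i) n).
Proof.
elim: {G}(size G) {-2}G (erefl (size G)) => [|n IHn] [|s G] //= => [_|[sG]].
  apply: ev_poly_sub_imp (ev_poly_const _ _ 0) => m _ ->.
  by apply: has_card0 => u [[]].
pose join u v : {ffun E -> nat} := [ffun x => maxn (u x) (v x)].
have := IHn [seq join s v | v <- G]; rewrite size_map => /(_ sG).
set A := fun m n => has_card _ n => Hinter.
have Hsum : ev_poly (\sum_i c i) (fun m t => exists x y, [/\ t = x + y,
    has_card (fun u => vec_le s u /\ forall i, a i + bsum u i = m i) x &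
    has_card (fun u => (exists2 s, s \in G & vec_le s u) /\
                       forall i, a i + bsum u i = m i) y]).
  by apply: ev_poly_add (ev_poly_cone a s) (IHn _ sG) => m x y Hx Hy; exists x, y.
apply: ev_poly_diff Hsum Hinter => m _ z [x [y [-> Hx Hy]]] Hz.
have [|k Hk kE] := has_card_union Hx Hy (c := z).
  apply: has_card_ext Hz => u; split.
    case=> -[_ /mapP[v vG ->] vu] um; do !split=> //.
      by move=> t; apply: leq_trans (vu t); rewrite ffunE leq_maxl.
    by exists v => // t; apply: leq_trans (vu t); rewrite ffunE leq_maxr.
  case=> -[su um] [[v vG vu] _]; split=> //; exists (join s v); first exact: map_f.
  by move=> t; rewrite ffunE geq_max su vu.
exists k => //; apply: has_card_ext Hk => u; split.
  case=> -[]; first by move=> su um; split=> //; exists s; rewrite ?mem_head.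
  by case=> v vG vu um; split=> //; exists v; rewrite ?inE ?vG ?orbT.
case=> -[v]; rewrite inE => /orP[/eqP->|vG] vu um; first by left.
by right; split=> //; exists v.
Qed.

Lemma ev_poly_up_closed (a : 'I_r -> nat) (U : {ffun E -> nat} -> Prop) :
    (forall u v, vec_le u v -> U u -> U v) ->
  ev_poly (\sum_i c i) (fun m n =>
    has_card (fun u => U u /\ forall i, a i + bsum u i = m i) n).
Proof.
move=> Uup; have [G [GU UG]] := dickson Uup.
apply: ev_poly_sub_imp (ev_poly_up a G) => m n.
apply: has_card_ext => u; split=> -[Hu um]; split=> //; last exact: UG.
by case: Hu => s /GU Us /Uup; apply.
Qed.

End Surjective.

End BlockCount.

(** * Words with gaps *)

Section Words.

Variable L : Type.
Implicit Types (w : seq (option L)) (rho : seq L) (g : nat -> nat).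

Definition insert (T : Type) (s : nat) (z : T) (w : seq T) : seq T :=
  take s w ++ z :: drop s w.

Lemma map_insert (T T' : Type) (f : T -> T') s z (w : seq T) :
  map f (insert s z w) = insert s (f z) (map f w).
Proof. by rewrite /insert map_cat map_take /= map_drop. Qed.

(* [g j] is the number of [None]s just before the [j]-th letter of [rho], and
   [g (size rho)] their number at the end. *)
Fixpoint expand rho g : seq (option L) :=
  nseq (g 0) None ++
  if rho is x :: rho' then Some x :: expand rho' (g \o succn) else [::].

Fixpoint gaps w : nat -> nat :=
  match w with
  | [::] => fun _ => 0
  | None :: w' => fun j => (j == 0) + gaps w' j
  | Some _ :: w' => fun j => if j is j'.+1 then gaps w' j' else 0
  end.

Lemma pmap_expand rho g : pmap id (expand rho g) = rho.
Proof.
have N n : pmap id (nseq n (@None L)) = [::] by elim: n.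
elim: rho g => [|x rho IHr] g /=; first by rewrite cats0.
by rewrite pmap_cat N /= IHr.
Qed.

Lemma size_expand rho g :
  size (expand rho g) = size rho + \sum_(j < (size rho).+1) g j.
Proof.
elim: rho g => [|x rho IHr] g /=.
  by rewrite cats0 size_nseq big_ord1.
rewrite size_cat size_nseq /= IHr [in RHS]big_ord_recl /= addnS addnCA.
by rewrite addSn.
Qed.

Lemma eq_expand rho g g' :
  (forall j, j <= size rho -> g j = g' j) -> expand rho g = expand rho g'.
Proof.
elim: rho g g' => [|x rho IHr] g g' gg' /=; first by rewrite gg'.
rewrite gg' //; congr (_ ++ _ :: _); apply: IHr => j jr.
exact: gg'.
Qed.

(** Together with [gaps_expand]: a word amounts to its letters other than [None] and its vector of
    gap lengths. *)
Lemma expand_gaps w : expand (pmap id w) (gaps w) = w.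
Proof.
elim: w => [|[x|] w IHw] //=.
  by congr cons; rewrite -[RHS]IHw; apply: eq_expand.
by rewrite -[in RHS]IHw; case: (pmap id w).
Qed.

Lemma gaps_expand rho g j : j <= size rho -> gaps (expand rho g) j = g j.
Proof.
have N n w i : gaps (nseq n None ++ w) i = (i == 0) * n + gaps w i.
  by elim: n => [|n IHn] /=; rewrite ?muln0 // IHn; case: eqP => /=; lia.
elim: rho g j => [|x rho IHr] g j /=; rewrite N.
  by rewrite leqn0 => /eqP-> /=; rewrite mul1n addn0.
by case: j => [|j] jr /=; rewrite ?mul1n ?addn0 // IHr.
Qed.

(** This translates the order on gap vectors into insertions of [None]. The place [s] found is the
    beginning of the [j]-th gap. *)
Lemma expand_incr rho g j : j <= size rho ->
  exists2 s, s <= size (expand rho g) &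
    expand rho (fun i => g i + (i == j)) = insert s None (expand rho g).
Proof.
elim: rho g j => [|x rho IHr] g [|j] jr //=.
- by exists 0; rewrite // /insert take0 drop0 addn1.
- exists 0; rewrite // /insert take0 drop0 addn1 /=; congr (_ :: _ ++ _ :: _).
  by apply: eq_expand => i _ /=; rewrite addn0.
have [s sr sE] := IHr (g \o succn) j jr.
exists (g 0 + s.+1); first by rewrite size_cat size_nseq /= leq_add2l.
rewrite addn0 /insert take_cat drop_cat size_nseq ltnNge leq_addr addKn /=.
rewrite -catA /=; congr (_ ++ _ :: _); rewrite -[RHS]sE.
exact: eq_expand.
Qed.

End Words.

Import Order.TTheory.

(** * Insertion and the lexicographic order *)

Section Lex.

Local Open Scope order_scope.

(** Between lists of equal length the first difference decides, and inserting the same entry at the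
    same place in both keeps it. *)
Lemma insert_lex_mono (x y : seqlexi nat) s z :
  size x = size y -> x < y -> (insert s z x : seqlexi nat) < (insert s z y : seqlexi nat).
Proof.
elim: s x y => [|s IHs] [|a x] [|b y] //= [sxy].
  by rewrite /insert /= !ltxi_cons lexx /=.
rewrite /insert /= !ltxi_cons => /andP[-> /=].
by move=> /implyP xy; apply/implyP => /xy; apply: IHs.
Qed.

Lemma insert_lex (x y : seqlexi nat) s z : size x = size y ->
  ((insert s z x : seqlexi nat) < (insert s z y : seqlexi nat)) = (x < y).
Proof.
move=> sxy; apply/idP/idP; last exact: insert_lex_mono.
apply: contraTT; rewrite -!leNgt le_eqVlt => /orP[/eqP->//|].
by move/(insert_lex_mono s z (esym sxy))/ltW.
Qed.

End Lex.

(** * Leading terms and dimension *)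

Section LeadingTerms.

Import GRing.Theory.
Local Open Scope ring_scope.

Lemma has_dim_bij (k : fieldType) (V : lmodType k) n (f : V -> 'rV[k]_n) :
    linear f -> (forall x, f x = 0 -> x = 0) -> (forall y, exists x, f x = y) ->
  has_dim V n.
Proof.
move=> fl finj fsurj.
have fB x y : f (x - y) = f x - f y by rewrite -scaleN1r addrC fl scaleN1r addrC.
have surj y : exists x, f x == y by have [x <-] := fsurj y; exists x.
pose g y := xchoose (surj y).
have fg : cancel g f by move=> y; apply/eqP; apply: (xchooseP (surj y)).
constructor; exists f => //; exists g => // x.
by apply/eqP; rewrite -subr_eq0; apply/eqP/finj; rewrite fB fg subrr.
Qed.

Variables (k : fieldType) (W : lmodType k) (B : finType).
Variable ev : W -> B -> k.
Hypothesis ev_linear : forall a x y b, ev (a *: x + y) b = a * ev x b + ev y b.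
Hypothesis ev_inj : forall x, (forall b, ev x b = 0) -> x = 0.
Variables (disp : Order.disp_t) (K : orderType disp) (key : B -> K).
Hypothesis key_inj : injective key.

(** The leading term of a vector is its nonzero coordinate of least key. *)
Definition is_lead (b : B) : Prop :=
  exists x, ev x b <> 0 /\ forall b', (key b' < key b)%O -> ev x b' = 0.

Lemma is_lead_ex x : x <> 0 -> exists2 b, is_lead b & ev x b <> 0.
Proof.
move=> x0; have [/forallP H|] := boolP [forall b, ev x b == 0].
  by case: x0; apply: ev_inj => b; apply/eqP.
rewrite negb_forall => /existsP[b0 xb0].
case: (@arg_minP _ _ _ b0 (fun b => ev x b != 0) key xb0) => b /eqP xb bmin.
exists b => //; exists x; split=> // b' b'b; apply/eqP; apply: contraTT b'b.
by rewrite -leNgt; apply: bmin.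
Qed.

(** The coordinates at the leading positions identify [W] with [k ^ n]: a nonzero vector does not
    vanish at its own leading position, and prescribed values are attained by successive
    correction. *)
Lemma has_dim_lead n : has_card is_lead n -> has_dim W n.
Proof.
move=> [s0 [us0 s0P <-]].
set s := sort (relpre key <=%O) s0.
have sP b : b \in s <-> is_lead b by rewrite mem_sort.
have ss : pairwise (relpre key <%O) s.
  rewrite -sorted_pairwise; last by move=> x y z /= /lt_trans; apply.
  rewrite -sorted_map lt_sorted_uniq_le map_inj_uniq // sort_uniq us0 /=.
  by rewrite sorted_map; apply: sort_sorted => x y /=; apply: le_total.
have -> : size s0 = size s by rewrite size_sort.
apply: (@has_dim_bij _ _ _ (fun x => \row_j ev x (tnth (in_tuple s) j))).
- by move=> a x y; apply/rowP=> j; rewrite !mxE ev_linear.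
- move=> x /rowP x0; apply: contrapT => /is_lead_ex[b /sP].
  by case/(tnthP (in_tuple s)) => j ->; have := x0 j; rewrite !mxE.
- move=> y.
pose z b := if insub (index b s) is Some j then y 0 j else 0.
suff [x xP] : exists x, forall b, b \in s -> ev x b = z b.
  exists x; apply/rowP=> j; rewrite !mxE xP ?mem_tnth // /z.
  have -> : index (tnth (in_tuple s) j) s = j.
    by rewrite (tnth_nth (tnth (in_tuple s) j)) index_uniq // sort_uniq.
  by rewrite valK.
have {sP} : forall b, b \in s -> is_lead b by move=> b /sP.
(* Positions come in increasing order of key, so a vector [w] leading at the last one, [b], vanishes
   at all earlier ones; a multiple of it corrects the value at [b] alone. *)
elim/last_ind: (s) ss => [|s' b IHs] /=; first by exists 0.
rewrite pairwise_rcons => /andP[/allP sb ss'] sP.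
have [c cs'|x xP] := IHs ss'; first by apply: sP; rewrite mem_rcons inE cs' orbT.
have [|w [/eqP wb wlt]] := sP b; first by rewrite mem_rcons mem_head.
exists (((z b - ev x b) / ev w b) *: w + x) => c.
rewrite mem_rcons inE ev_linear => /orP[/eqP->|cs']; first by rewrite divfK // subrK.
by rewrite (wlt c) ?mulr0 ?add0r ?xP //; apply: sb.
Qed.

End LeadingTerms.

(** Reduces upward closure to unit increments, by induction on the total excess of [v] over [u]. *)
Lemma vec_le_ind (E : finType) (U : {ffun E -> nat} -> Prop) :
    (forall u x, U u -> U [ffun y => u y + (y == x)]) ->
  forall u v, vec_le u v -> U u -> U v.
Proof.
move=> step u v; elim: {v}(\sum_x (v x - u x)) {-2}v (erefl (\sum_x (v x - u x))).
  move=> v /eqP; rewrite sum_nat_eq0 => /forallP /= H uv.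
  suff -> : u = v by [].
  by apply/ffunP=> x; apply/eqP; rewrite eqn_leq uv; have := H x; rewrite subn_eq0.
move=> n IHn v Hn uv Uu.
have [x xlt] : exists x, u x < v x.
  have [/existsP//|] := boolP [exists x, u x < v x].
  rewrite negb_exists => /forallP H; move: Hn; rewrite big1 // => x _.
  by apply/eqP; rewrite subn_eq0 leqNgt.
pose v' : {ffun E -> nat} := [ffun y => v y - (y == x)].
have -> : v = [ffun y => v' y + (y == x)].
  by apply/ffunP=> y; rewrite !ffunE subnK //; case: eqP => [->|//]; apply: leq_trans xlt.
apply: step; apply: IHn Uu => [|y]; last first.
  by rewrite ffunE; case: eqP => [->|_]; [have := uv x; lia|rewrite subn0].
apply/eqP; rewrite -eqSS -Hn (bigD1 x) //= [X in _ == X](bigD1 x) //= ffunE eqxx.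
apply/eqP; rewrite -addSn; congr addn; first by lia.
by apply: eq_bigr => y /negbTE yx; rewrite ffunE yx subn0.
Qed.

Section InsertCat.
Variable T : Type.
Implicit Types a b c : seq T.

Lemma insert_cons x a s z : insert s.+1 z (x :: a) = x :: insert s z a :> seq T.
Proof. by []. Qed.

Lemma insert_catr a b s z : insert (size a + s) z (a ++ b) = a ++ insert s z b.
Proof. by rewrite /insert take_cat drop_cat ltnNge leq_addr addKn /= catA. Qed.

Lemma insert_catl a b s z : s <= size a -> insert s z (a ++ b) = insert s z a ++ b.
Proof.
move=> sa; rewrite /insert -catA /=.
rewrite -{1 2}(cat_take_drop s a) -!catA.
by rewrite take_size_cat ?drop_size_cat // size_takel.
Qed.

End InsertCat.

Definition incr (r : nat) (m : 'I_r -> nat) (i : 'I_r) : 'I_r -> nat :=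
  fun l => m l + (l == i).

(** * Families of vector spaces with coordinates labelled by words *)

Section Coded.

Variables (k : fieldType) (r d : nat) (A L : finType).
Variables (B : ('I_r -> nat) -> finType) (W : ('I_r -> nat) -> lmodType k).
(* [ev x] is the family of coordinates of [x] on a basis indexed by [B m]. *)
Variable ev : forall m, W m -> B m -> k.
(** The first component is the part of a label that does not grow with [m]: for contractions, the
    values on the vertices of the original tree. *)
Variable code : forall m, B m -> A * {ffun 'I_r -> seq (option L)}.

Hypothesis code_inj : forall m, injective (@code m).
Hypothesis code_size : forall m b i, size ((@code m b).2 i) = m i.
Hypothesis code_bound : forall m b, \sum_i size (pmap id ((@code m b).2 i)) <= d.
Hypothesis ev_linear : forall m a (x y : W m) b,
  (ev (a *: x + y) b = a * ev x b + ev y b)%R.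
Hypothesis ev_inj : forall m (x : W m), (forall b, ev x b = 0%R) -> x = 0%R.
(** [F] stands for the action of the contraction of one new edge, and [phi] for its effect on basis
    vectors. *)
Hypothesis insert_act : forall m i s, s <= m i ->
  exists (phi : B m -> B (incr m i)) (F : W m -> W (incr m i)),
    (forall b, code (phi b) =
       ((code b).1, upd (code b).2 i (insert s None ((code b).2 i)))) /\
    (forall x b', ev (F x) b' = \sum_(b | phi b == b') ev x b)%R.

Definition letter (o : option L) : nat := enum_rank o.

(** All words are strung into one list, whose length depends only on [m], so that insertion into one
    word becomes insertion into a single list. *)
Definition key m (b : B m) : seqlexi nat :=
  nat_of_ord (enum_rank (code b).1) ::
  flatten [seq map letter ((code b).2 i) | i <- enum 'I_r].

Lemma letter_inj : injective letter.
Proof. by move=> x y /val_inj/enum_rank_inj. Qed.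

Lemma key_inj m : injective (@key m).
Proof.
move=> b b' [] /val_inj/enum_rank_inj e1 e2; apply: code_inj.
rewrite [LHS]surjective_pairing [RHS]surjective_pairing e1; congr pair.
have : shape [seq map letter ((code b).2 i) | i <- enum 'I_r] =
       shape [seq map letter ((code b').2 i) | i <- enum 'I_r].
  rewrite /shape -!map_comp; apply: eq_map => i /=.
  by rewrite !size_map !code_size.
move/(eq_from_flatten_shape e2) => e3; apply/ffunP=> i.
apply: (inj_map letter_inj).
have /eq_in_map/(_ i) := e3; apply; exact: mem_enum.
Qed.

Lemma size_key m (b b' : B m) : size (key b) = size (key b').
Proof.
rewrite /= !size_flatten /shape -!map_comp; congr (sumn _).+1.
by apply: eq_map => i /=; rewrite !size_map !code_size.
Qed.

(** The point is that [t] is independent of [b]: the words before the [i]-th have lengths fixed by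
    [m]. *)
Lemma key_insert m i s (phi : B m -> B (incr m i)) : s <= m i ->
    (forall b, code (phi b) =
       ((code b).1, upd (code b).2 i (insert s None ((code b).2 i)))) ->
  exists t, forall b, key (phi b) = insert t (letter None) (key b).
Proof.
move=> si phiE.
have : i \in enum 'I_r by rewrite mem_enum.
case/path.splitPr eE: {2}_ / => [l1 l2].
have : uniq (enum 'I_r) by rewrite enum_uniq.
rewrite eE cat_uniq /= negb_or => /and3P[_ /andP[il1 _] /andP[il2 _]].
pose n := \sum_(l <- l1) m l.
(* The successor accounts for the rank of the first component at the head of the key. *)
exists (n + s).+1 => b; rewrite /key phiE /= eE.
rewrite insert_cons; congr cons.
rewrite !map_cat !flatten_cat /= !ffunE eqxx.
have same l : i \notin l ->
   [seq [seq letter i1 | i1 <- upd (code b).2 i (insert s None ((code b).2 i)) i0] | i0 <- l]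
   = [seq [seq letter i1 | i1 <- (code b).2 i0] | i0 <- l].
  move=> il; apply/eq_in_map => j jl; rewrite ffunE; case: eqP => // ji.
  by rewrite -ji jl in il.
rewrite !same // map_insert -insert_catl ?size_map ?code_size //.
rewrite -insert_catr; congr (insert (_ + s)); rewrite size_flatten /shape -map_comp.
rewrite sumnE big_map; apply: eq_bigr => j _ /=.
by rewrite size_map code_size.
Qed.

Local Notation lead m := (is_lead (@ev m) (@key m)).

(** By [insert_lex] the map [phi] preserves and reflects the order of keys. So it is injective, and
    [F] takes a vector with leading position [b] to one with leading position [phi b]. *)
Lemma lead_insert m i s : s <= m i ->
  exists2 phi : B m -> B (incr m i),
    forall b, code (phi b) =
       ((code b).1, upd (code b).2 i (insert s None ((code b).2 i))) &
    forall b, lead m b -> lead (incr m i) (phi b).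
Proof.
move=> si; have [phi [F [phiE FE]]] := insert_act si; exists phi => //.
have [t kE] := key_insert si phiE.
have key_lt b b' : (key (phi b) < key (phi b'))%O = (key b < key b')%O.
  by rewrite !kE; apply: insert_lex; apply: size_key.
have phi_inj : injective phi.
  move=> b b' e; apply: key_inj; apply/eqP.
  rewrite eq_le !leNgt -!key_lt e ltxx //.
move=> b [x [xb xlt]]; exists (F x); split=> [|b' b'b].
  by rewrite FE (big_pred1 b) // => c; rewrite (inj_eq phi_inj).
rewrite FE big1 // => c /eqP cb'; apply: xlt.
by rewrite -key_lt cb'.
Qed.

(** What remains of a code when the [None]s are deleted. The bound [d] makes this a finite type, so
    that counts can be summed over it. *)
Definition colour : finType := (A * {ffun 'I_r -> {bseq d of L}})%type.

Section Colour.

Variable c : colour.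

(** The slots are the gaps: one before each letter and one at the end of each word. *)
Definition slot : finType := {i : 'I_r & 'I_(size (c.2 i)).+1}.

Definition mk_slot i (j : 'I_(size (c.2 i)).+1) : slot := existT _ i j.

Definition slot_blk (x : slot) : 'I_r := tag x.

Definition slot_word (u : {ffun slot -> nat}) : {ffun 'I_r -> seq (option L)} :=
  [ffun i => expand (c.2 i)
    (fun j => u (mk_slot (inord j : 'I_(size (c.2 i)).+1)))].

Lemma bsum_slot (F : slot -> nat) i :
  \sum_(x | slot_blk x == i) F x =
  \sum_(j < (size (c.2 i)).+1) F (mk_slot j).
Proof.
transitivity (\sum_(i' | i' == i) \sum_(j < (size (c.2 i')).+1)
    F (mk_slot j)); last by rewrite big_pred1_eq.
rewrite (sig_big_dep _ _ (fun i j => F (mk_slot j))).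
by apply: eq_big => [p|[i' j]] //=; rewrite andbT.
Qed.

Lemma card_slot i : #|[set x | slot_blk x == i]| = (size (c.2 i)).+1.
Proof. by rewrite -sum1dep_card bsum_slot sum1_card card_ord. Qed.

Lemma size_slot_word u i :
  size (slot_word u i) = size (c.2 i) + bsum slot_blk u i.
Proof.
rewrite ffunE size_expand /bsum bsum_slot; congr addn.
by apply: eq_bigr => j _; rewrite inord_val.
Qed.

Lemma slot_word_inj : injective slot_word.
Proof.
move=> u v /ffunP uv; apply/ffunP => -[i j].
have := congr1 (fun w => gaps w j) (uv i).
by rewrite !ffunE !gaps_expand ?inord_val // -ltnS.
Qed.

Lemma slot_word_gaps (w : 'I_r -> seq (option L)) :
    (forall i, pmap id (w i) = c.2 i) ->
  slot_word [ffun x : slot => gaps (w (tag x)) (tagged x : 'I__)] =1 w.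
Proof.
move=> wc i; rewrite ffunE -[RHS]expand_gaps wc; apply: eq_expand => j js.
by rewrite ffunE /= inordK.
Qed.

Lemma slot_word_incr u (x : slot) :
  exists2 s, s <= size (slot_word u (tag x)) &
    slot_word [ffun y => u y + (y == x)] =
    upd (slot_word u) (tag x) (insert s None (slot_word u (tag x))).
Proof.
case: x => i j /=.
have [|s ss sE] := @expand_incr _ (c.2 i)
  (fun j => u (mk_slot (inord j : 'I_(size (c.2 i)).+1))) j.
  by rewrite -ltnS.
exists s; rewrite ffunE //; apply/ffunP => l; rewrite !ffunE -sE.
case: eqP => [->|li]; apply: eq_expand => t tl; rewrite ffunE; last first.
  by case: eqP => [/(congr1 tag) /= /li //|_]; rewrite addn0.
congr addn; rewrite eq_Tagged /= -(inj_eq val_inj) /= inordK //.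
Qed.

(** All [m] are put together in one set of gap vectors, to which Dickson's lemma applies; [m] can be
    read off from the lengths of the words. *)
Definition colour_up (u : {ffun slot -> nat}) : Prop :=
  exists m (b : B m), lead m b /\ code b = (c.1, slot_word u).

Lemma colour_up_closed u v : vec_le u v -> colour_up u -> colour_up v.
Proof.
apply: vec_le_ind => {}u x [m [b [lb cb]]].
have [s ss sE] := slot_word_incr u x.
have [|phi phiE philead] := @lead_insert m (tag x) s.
  by rewrite -(code_size b) cb.
exists (incr m (tag x)), (phi b); split; first exact: philead.
by rewrite phiE cb /= sE.
Qed.

(** A word with [n] letters has [n + 1] gaps and contributes [n] to the degree, so the degree is the
    total number of letters. A colour with more than [d] letters in all is not the colour of any
    code, by [code_bound]. *)
Lemma ev_poly_colour : ev_poly d (fun m n => has_card (fun u => colour_up u /\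
    forall i, size (c.2 i) + bsum slot_blk u i = m i) n).
Proof.
have [cd|cd] := leqP (\sum_i size (c.2 i)) d.
  apply: ev_poly_leq cd _; apply: ev_poly_up_closed card_slot _ _ colour_up_closed.
apply: ev_poly_sub_imp (ev_poly_const _ _ 0) => m _ ->.
apply: has_card0 => u [[m' [b [_ cb]]] _].
have := code_bound b; rewrite leqNgt => /negP; apply; rewrite cb /=.
by under eq_bigr do rewrite ffunE pmap_expand.
Qed.

End Colour.

(** The codes of leading terms are sorted by colour, and within a colour they correspond to gap
    vectors. *)
Theorem ev_poly_has_dim : ev_poly d (fun m n => has_dim (W m) n).
Proof.
suff H : ev_poly d (fun m n => has_card (lead m) n).
  apply: ev_poly_sub_imp H => m n.
  by apply: has_dim_lead; [apply: ev_linear|apply: ev_inj|apply: key_inj].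
apply: ev_poly_sum ev_poly_colour => m F HF.
apply: (@has_card_preim _ _ (@code m)) => [b b' _ _|]; first exact: code_inj.
pose Q (c : colour) y := exists2 u, colour_up u /\
    forall i, size (c.2 i) + bsum (@slot_blk c) u i = m i & y = (c.1, slot_word u).
have QF c : c \in index_enum colour -> has_card (Q c) (F c).
  by move=> _; apply: has_card_image (HF c) => u v _ _ [] /slot_word_inj.
have Qd c c' y : Q c y -> Q c' y -> c = c'.
  case: c c' => [a rho] [a' rho'] [u _ ->] [v _ [-> uv]]; congr pair.
  apply/ffunP=> i; apply: val_inj; have /ffunP/(_ i) := uv.
  by rewrite !ffunE => /(congr1 (pmap id)); rewrite !pmap_expand.
have := has_card_bigunion (index_enum_uniq _) Qd QF.
apply: has_card_ext => y; split=> [[c _ [u [[m' [b [lb cb]]] um] ->]]|[b lb ->]].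
  (* The [m'] hidden in [colour_up] has to be [m], both being the lengths of the same words. *)
  suff mm : m' = m by case: _ / mm b lb cb => b lb cb; exists b.
  by apply: funext => i; rewrite -(code_size b) cb size_slot_word um.
(* The default of [insub_bseq] is never taken, as [code_bound] bounds each word separately too. *)
pose c : colour := ((code b).1, [ffun i => insub_bseq d (pmap id ((code b).2 i))]).
have cE i : pmap id ((code b).2 i) = c.2 i.
  rewrite ffunE /insub_bseq val_insubd.
  by rewrite (leq_trans _ (code_bound b)) // (bigD1 i) //= leq_addr.
pose u : {ffun slot c -> nat} := 
  [ffun x : slot c => gaps ((code b).2 (tag x)) (tagged x : 'I__)].
have uE : (c.1, slot_word u) = code b.
  rewrite [RHS]surjective_pairing; congr pair; apply/ffunP.
  exact: slot_word_gaps cE.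
exists c; first exact: mem_index_enum.
exists u => //; split=> [|i]; first by exists m, b.
by rewrite -size_slot_word -[m i](code_size b) -uE.
Qed.

End Coded.

(** * Dimensions and modules *)

Section Dimension.

Import GRing.Theory.
Local Open Scope ring_scope.

Variable k : fieldType.
Implicit Types U V W : lmodType k.

Lemma linear_fun0 U V (f : U -> V) : linear f -> f 0 = 0.
Proof. by move=> fl; have := fl (-1) 0 0; rewrite scaler0 addr0 scaleN1r addNr. Qed.

Lemma linear_funD U V (f : U -> V) : linear f -> {morph f : x y / x + y}.
Proof. by move=> fl x y; have := fl 1 x y; rewrite !scale1r. Qed.

Lemma linear_funZ U V (f : U -> V) a : linear f -> {morph f : x / a *: x}.
Proof. by move=> fl x; have := fl a x 0; rewrite (linear_fun0 fl) !addr0. Qed.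

Lemma linear_funB U V (f : U -> V) : linear f -> {morph f : x y / x - y}.
Proof. by move=> fl x y; rewrite -scaleN1r addrC fl scaleN1r addrC. Qed.

Lemma linear_fun_sum U V (f : U -> V) (I : Type) (s : seq I) (F : I -> U) :
  linear f -> f (\sum_(i <- s) F i) = \sum_(i <- s) f (F i).
Proof.
move=> fl; elim: s => [|i s IHs]; first by rewrite !big_nil linear_fun0.
by rewrite !big_cons linear_funD // IHs.
Qed.

Lemma has_dim_iso U V n (f : U -> V) :
  linear f -> bijective f -> has_dim V n -> has_dim U n.
Proof.
move=> fl fb [[g gl gb]]; constructor; exists (g \o f); last exact: bij_comp.
by move=> a x y /=; rewrite fl gl.
Qed.

(** The two changes of coordinates are matrices with [F *m G = 1], which gives one inequality; the
    other is symmetric. *)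
Lemma has_dim_unique V a b : has_dim V a -> has_dim V b -> a = b.
Proof.
suff le c d : has_dim V c -> has_dim V d -> (c <= d)%N.
  by move=> Va Vb; apply/eqP; rewrite eqn_leq !le.
move=> [[f fl [f' ff' f'f]]] [[g gl [g' gg' g'g]]].
have f'l : linear f'.
  by move=> t x y; apply: (can_inj ff'); rewrite f'f fl !f'f.
have g'l : linear g'.
  by move=> t x y; apply: (can_inj gg'); rewrite g'g gl !g'g.
pose F := \matrix_i g (f' (delta_mx 0 i)); pose G := \matrix_i f (g' (delta_mx 0 i)).
have FE u : u *m F = g (f' u).
  rewrite mulmx_sum_row {2}[u]row_sum_delta !linear_fun_sum //.
  by apply: eq_bigr => i _; rewrite rowK !linear_funZ.
have GE u : u *m G = f (g' u).
  rewrite mulmx_sum_row {2}[u]row_sum_delta !linear_fun_sum //.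
  by apply: eq_bigr => i _; rewrite rowK !linear_funZ.
apply: (@mulmx1_min _ _ _ F G); apply/row_matrixP => i.
by rewrite rowE mulmxA FE GE gg' f'f rowE mulmx1.
Qed.

Lemma spanned_has_dim V n (w : 'I_n -> V) :
  (forall x, exists y : 'rV[k]_n, x = \sum_i y 0 i *: w i) ->
  exists c, has_dim V c.
Proof.
elim: n w => [|n IHn] w span.
  exists 0%N; apply: (@has_dim_bij _ _ _ (fun _ => 0)).
  - by move=> a x y; rewrite scaler0 addr0.
  - by move=> x _; have [y ->] := span x; rewrite big_ord0.
  - by move=> y; exists 0; apply/rowP => -[].
have [ind|] := EM (forall y : 'rV[k]_n.+1, \sum_i y 0 i *: w i = 0 -> y = 0).
  pose g (y : 'rV[k]_n.+1) := \sum_i y 0 i *: w i.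
  have gl : linear g.
    move=> a x y; rewrite /g scaler_sumr -big_split; apply: eq_bigr => i _.
    by rewrite !mxE scalerDl scalerA.
  (* Coordinates are chosen arbitrarily; independence makes them unique, hence linear. *)
  have [f fK] := choice span.
  have gf x : g (f x) = x by rewrite /g -fK.
  exists n.+1; apply: (@has_dim_bij _ _ _ f).
  - move=> a x y; apply/eqP; rewrite -subr_eq0; apply/eqP/ind.
    by rewrite -[LHS]/(g _) linear_funB // gl !gf subrr.
  - by move=> x fx; rewrite -(gf x) fx linear_fun0.
  - move=> y; exists (g y); apply/eqP; rewrite -subr_eq0; apply/eqP/ind.
    by rewrite -[LHS]/(g _) linear_funB // gf subrr.
move/existsNP=> [c /not_implyP[cw c0]].
have [j cj] : exists j, c 0 j != 0.
  by apply/rV0Pn/eqP.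
apply: (IHn (w \o lift j)) => x; have [y xE] := span x.
(* Subtracting [y 0 j / c 0 j] times the relation cancels the coefficient of [w j]. *)
exists (\row_i (y 0 (lift j i) - y 0 j / c 0 j * c 0 (lift j i))).
transitivity (x - (y 0 j / c 0 j) *: \sum_i c 0 i *: w i).
  by rewrite cw scaler0 subr0.
rewrite {1}xE scaler_sumr -sumrB (bigD1_ord j) //= scalerA divfK // subrr add0r.
by apply: eq_bigr => i _; rewrite mxE scalerBl scalerA.
Qed.

Lemma has_dim_quotient V W n (g : V -> W) :
  linear g -> (forall y, exists x, g x = y) -> has_dim V n -> exists c, has_dim W c.
Proof.
move=> gl gs [[f fl [f' ff' f'f]]].
have f'l : linear f'.
  by move=> t x y; apply: (can_inj ff'); rewrite f'f fl !f'f.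
apply: (@spanned_has_dim _ n (fun i => g (f' (delta_mx 0 i)))) => y.
have [x <-] := gs y; exists (f x).
rewrite -{1}[x]ff' {1}[f x]row_sum_delta !linear_fun_sum //.
by apply: eq_bigr => i _; rewrite !linear_funZ.
Qed.

(** Additivity on short exact sequences: [s] is a linear section of [g] through lifts of a basis of
    [W], and [h] is the projection to [U] that it defines. *)
Lemma has_dim_extension U V W b c (f : U -> V) (g : V -> W) :
    linear f -> linear g -> injective f -> (forall y, exists x, g x = y) ->
    (forall x, g x = 0 <-> exists u, f u = x) ->
  has_dim U b -> has_dim W c -> has_dim V (b + c).
Proof.
move=> fl gl fi gs fg [[p pl [p' pp' p'p]]] [[q ql [q' qq' q'q]]].
have [v vE] := choice (fun j : 'I_c => gs (q' (delta_mx 0 j))).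
pose s y := \sum_j q y 0 j *: v j.
have sl : linear s.
  move=> a x y; rewrite /s scaler_sumr -big_split; apply: eq_bigr => i _.
  by rewrite ql !mxE scalerDl scalerA.
have q'l : linear q'.
  by move=> t x y; apply: (can_inj qq'); rewrite q'q ql !q'q.
have gsK y : g (s y) = y.
  rewrite -[RHS]qq' [q y]row_sum_delta /s !linear_fun_sum //.
  by apply: eq_bigr => i _; rewrite !linear_funZ // vE.
have [x|h hE] := choice (fun x => (fg (x - s (g x))).1 _).
  by rewrite linear_funB // gsK subrr.
have hl : linear h.
  move=> a x y; apply: fi; rewrite fl !hE gl sl.
  by rewrite scalerBr opprD addrACA.
apply: (@has_dim_bij _ _ _ (fun x => row_mx (p (h x)) (q (g x)))).
- by move=> a x y; rewrite hl gl pl ql scale_row_mx add_row_mx.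
- move=> x /eqP; rewrite -row_mx0 => /eqP/eq_row_mx[ph qg].
  have gx0 : g x = 0 by rewrite -[LHS]qq' qg linear_fun0.
  have hx0 : h x = 0.
    by apply: (can_inj pp'); rewrite ph linear_fun0.
  by have := hE x; rewrite hx0 gx0 (linear_fun0 fl) (linear_fun0 sl) subr0.
- move=> y; exists (f (p' (lsubmx y)) + s (q' (rsubmx y))).
  have gE : g (f (p' (lsubmx y)) + s (q' (rsubmx y))) = q' (rsubmx y).
    by rewrite linear_funD // gsK (fg _).2 ?add0r //; exists (p' (lsubmx y)).
  have hE' : h (f (p' (lsubmx y)) + s (q' (rsubmx y))) = p' (lsubmx y).
    by apply: fi; rewrite hE gE addrK.
  by rewrite gE hE' p'p q'q hsubmxK.
Qed.

Lemma has_dim_dsum (I : finType) (V : I -> lmodType k) (c : I -> nat) :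
  (forall i, has_dim (V i) (c i)) -> has_dim (dsum V) (\sum_i c i).
Proof.
move=> Vc.
have Vc' i : {f : V i -> 'rV[k]_(c i) | linear f /\ bijective f}.
  by apply: cid; have [[f fl fb]] := Vc i; exists f.
pose f i := sval (Vc' i).
have fl i : linear (f i) by case: (svalP (Vc' i)).
have fb i : bijective (f i) by case: (svalP (Vc' i)).
pose J : finType := {i : I & 'I_(c i)}.
have <- : #|J| = (\sum_i c i)%N.
  by rewrite card_tagged sumnE big_map big_enum; apply: eq_bigr => i _; rewrite card_ord.
apply: (@has_dim_bij _ _ _ (fun x : dsum V => \row_j f (tag (enum_val j : J)) (x (tag (enum_val j))) 0
   (tagged (enum_val j)))).
- by move=> a x y; apply/rowP => j; rewrite !mxE dsumDE dsumZE fl !mxE.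
- move=> x /rowP x0; apply/ffunP=> i; rewrite [RHS]ffunE; apply: (bij_inj (fb i)).
  rewrite linear_fun0 //; apply/rowP => j; rewrite mxE.
  by have := x0 (enum_rank (Tagged _ j : J)); rewrite !mxE enum_rankK.
- move=> y; have g i : {g | cancel g (f i)}.
    by apply: cid; have [g _ gf] := fb i; exists g.
  exists [ffun i => sval (g i) (\row_j y 0 (enum_rank (Tagged _ j : J)))].
  apply/rowP => j; rewrite mxE ffunE (svalP (g _)) mxE.
  by congr (y 0 _); rewrite -[RHS]enum_valK; case: (enum_val j).
Qed.

End Dimension.

(** * Preimage of a submodule under a morphism of modules *)

Section Preimage.

Import GRing.Theory.
Local Open Scope ring_scope.

Variables (k : fieldType) (C : treeCat) (P G : opmod k C).
Variable f : forall X : C, P X -> G X.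
Hypothesis f_linear : forall X, linear (@f X).
Hypothesis f_act : forall X Y (h : Defs.hom X Y) x, f (act P h x) = act G h (f x).
Variable A : subopmod G.

Definition preim_pred X : {pred P X} := [pred x | f x \in A X].
Arguments preim_pred : clear implicits.

Lemma preim_closed X : submod_closed (preim_pred X).
Proof.
split=> [|a x y]; rewrite !inE ?linear_fun0 ?rpred0 // => fx fy.
by rewrite f_linear rpredD ?rpredZ.
Qed.

HB.instance Definition _ X :=
  GRing.isSubmodClosed.Build k (P X) (preim_pred X) (preim_closed X).

Lemma preim_act X Y (h : Defs.hom X Y) x :
  x \in preim_pred Y -> act P h x \in preim_pred X.
Proof. by rewrite !inE f_act; apply: smem_act. Qed.

Definition preim_sub : subopmod P :=
  @SubOpMod k C P (fun X => preim_pred X : submodClosed _) preim_act.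

Lemma preim_subE X x : (x \in preim_sub X) = (f x \in A X).
Proof. by []. Qed.

End Preimage.

(** * A submodule of a submodule, seen in the ambient module *)

Section Extension.

Import GRing.Theory.
Local Open Scope ring_scope.

Variables (k : fieldType) (C : treeCat) (G : opmod k C) (A : subopmod G).
Variable B : subopmod (sub_mod A).

(** Membership must be boolean: [insub] first decides whether [x] lies in [A]. *)
Definition ext_pred X : {pred G X} :=
  [pred x | if insub x is Some y then (y : sub_mod A X) \in B X else false].
Arguments ext_pred : clear implicits.

Lemma ext_predP X (x : G X) :
  reflect (exists2 y : sub_mod A X, y \in B X & sub_val y = x) (x \in ext_pred X).
Proof.
apply: (iffP idP); rewrite inE /=.
  by case: insubP => // y _ yx By; exists y.
by case=> y By <-; rewrite (valK (y : sub_ob A X)).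
Qed.

Lemma ext_closed X : submod_closed (ext_pred X).
Proof.
split; first by apply/ext_predP; exists 0; rewrite ?rpred0.
move=> a _ _ /ext_predP[x Bx <-] /ext_predP[y By <-]; apply/ext_predP.
by exists (a *: x + y) => //; rewrite rpredD ?rpredZ.
Qed.

HB.instance Definition _ X :=
  GRing.isSubmodClosed.Build k (G X) (ext_pred X) (ext_closed X).

Lemma ext_act X Y (h : Defs.hom X Y) x :
  x \in ext_pred Y -> act G h x \in ext_pred X.
Proof.
move=> /ext_predP[y By <-]; apply/ext_predP.
by exists (act (sub_mod A) h y) => //; apply: smem_act.
Qed.

Definition ext_sub : subopmod G :=
  @SubOpMod k C G (fun X => ext_pred X : submodClosed _) ext_act.

End Extension.

(** * Filtrations preserve dimension *)

Section Graded.

Import GRing.Theory.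
Local Open Scope ring_scope.

(** Each graded piece is a quotient of the associated graded module, hence finite-dimensional; the
    dimensions of the [F i] then follow by induction from the extensions of each piece by the step
    below it. *)
Lemma has_dim_graded (k : fieldType) (C : treeCat) (M : opmod k C) n
    (F : nat -> subopmod M) (X : C) c :
  is_filtration n F -> has_dim (assoc_graded n F X) c -> has_dim (M X) c.
Proof.
move=> [F0 Fn Fi] grc.
have Vq (i : 'I_n) : exists a, has_dim (quot_mod (restrict (F i) (F i.+1)) X) a.
  pose g (x : assoc_graded n F X) := (x : dsum _) i.
  apply: (has_dim_quotient (g := g)) grc => [a x y|y].
    by rewrite /g dsumDE dsumZE.
  pose V (j : 'I_n) := quot_mod (restrict (F j) (F j.+1)) X.
  (* The family with [y] at [i] and zero elsewhere; the cast is due to the summands having different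
     types. *)
  exists ([ffun j => if j =P i is ReflectT ji then
    ecast l (V l) (esym ji) y else 0] : dsum V).
  rewrite /g ffunE; case: eqP => // ji.
  by rewrite (eq_irrelevance ji erefl).
have [a aE] := choice Vq.
have -> : c = (\sum_i a i)%N.
  by apply: has_dim_unique grc _; apply: has_dim_dsum.
(* [a] extended by zero to all naturals, so that partial sums need no ordinals below [n]. *)
pose b i := oapp a 0%N (insub i).
have Fdim i : (i <= n)%N -> has_dim (sub_mod (F i) X) (\sum_(j < i) b j)%N.
  elim: i => [_|i IHi lin].
    rewrite big_ord0; apply: (@has_dim_bij _ _ _ (fun _ => 0)).
    - by move=> t x y; rewrite scaler0 addr0.
    - by move=> x _; apply: val_inj; apply/eqP; rewrite -F0; apply: valP.
    - by move=> y; exists 0; apply/rowP => -[].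
  rewrite big_ord_recr /=.
  have -> : b i = a (Ordinal lin) by rewrite /b insubT.
  have FS x : x \in F i X -> x \in F i.+1 X by apply: Fi.
  pose f (x : sub_mod (F i) X) : sub_mod (F i.+1) X := SubOb (FS _ (valP x)).
  apply: (has_dim_extension (f := f) (g := lpi (restrict (F i) (F i.+1) X)))
    (IHi (ltnW lin)) (aE (Ordinal lin)).
  - by move=> t x y; apply: val_inj.
  - exact: linearP.
  - by move=> x y /(congr1 val) xy; apply: val_inj; exact: xy.
  - by move=> y; exists (lrepr y); apply: lreprK.
  move=> x; split.
    rewrite -(raddf0 (lpi (restrict (F i) (F i.+1) X))) => /lpi_eq; rewrite subr0 => xF.
    have xF' : sub_val x \in F i X := xF.
    by exists (SubOb xF'); apply: val_inj.
  case=> u <-; rewrite -(raddf0 (lpi (restrict (F i) (F i.+1) X))); apply/lpi_eq.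
  by rewrite subr0; apply: (valP u).
have -> : (\sum_i a i = \sum_(j < n) b j)%N.
  by apply: eq_bigr => i _; rewrite /b valK.
pose f (x : M X) : sub_mod (F n) X := SubOb (Fn X x).
apply: (has_dim_iso (f := f)) (Fdim n (leqnn n)); first by move=> t x y; apply: val_inj.
by exists (@sub_val _ _ _ _ _) => // x; apply: val_inj.
Qed.

End Graded.

(** * Smallish modules along a family of objects with word-coded morphisms *)

Section WordCoded.

Import GRing.Theory.
Local Open Scope ring_scope.

Variables (C : treeCat) (r : nat) (X : ('I_r -> nat) -> C).
Variables (A0 L0 : C -> finType).
Variable code : forall m S, Defs.hom (X m) S -> A0 S * {ffun 'I_r -> seq (option (L0 S))}.
Hypothesis code_inj : forall m S, injective (@code m S).
Hypothesis code_size : forall m S h i, size ((@code m S h).2 i) = m i.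
Hypothesis code_bound : forall m S h,
  (\sum_i size (pmap id ((@code m S h).2 i)) <= num_edges (utree S))%N.
(** One morphism [pi] serves all targets [S], so it inserts at the same place in all summands of a
    sum of principal projectives. *)
Hypothesis code_insert : forall m i s, (s <= m i)%N ->
  exists pi : Defs.hom (X (incr m i)) (X m), forall S (h : Defs.hom (X m) S),
    code (hom_comp h pi) =
      ((code h).1, upd (code h).2 i (insert s None ((code h).2 i))).

Variables (k : fieldType) (d : nat).

Section Submodule.

Variables (n : nat) (S : 'I_n -> C).
Hypothesis Sd : forall i, (num_edges (utree (S i)) <= d)%N.
Variable A : subopmod (dsum_mod (fun i => proj_mod k (S i))).

Definition basis m : finType := {i : 'I_n & Defs.hom (X m) (S i)}.

Definition basis_ev m (x : sub_mod A (X m)) (b : basis m) : k :=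
  (sub_val x : dsum (fun i => {ffun Defs.hom (X m) (S i) -> k^o})) (tag b) (tagged b).

(** Tagging with the summand merges the alphabets of the various [S i] into a single finite one. *)
Definition basis_code m (b : basis m) :
    {i : 'I_n & A0 (S i)} * {ffun 'I_r -> seq (option {i : 'I_n & L0 (S i)})} :=
  (Tagged (fun i => A0 (S i)) (code (tagged b)).1,
   [ffun l => map (omap (fun x => Tagged (fun i => L0 (S i)) x))
                ((code (tagged b)).2 l)]).

Lemma pmap_omap (T T' : Type) (f : T -> T') s :
  pmap id (map (omap f) s) = map f (pmap id s).
Proof. by elim: s => [|[x|] s IHs] //=; rewrite IHs. Qed.

(** The submodule inherits the coordinates of the ambient sum of principal projectives, whose basis
    is permuted into the larger one by composition with [pi]. *)
Lemma ev_poly_submodule : eventually_poly d (fun m => sub_mod A (X m)).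
Proof.
apply: (@ev_poly_has_dim k r d _ _ basis (fun m => sub_mod A (X m)) basis_ev basis_code).
- move=> m [i h] [j h'] [] ij; case: _ / ij h' => h' /eqP; rewrite eq_Tagged /= => /eqP e1.
  move=> /ffunP e2; congr existT; apply: code_inj.
  rewrite [LHS]surjective_pairing [RHS]surjective_pairing e1; congr pair.
  apply/ffunP=> l; have := e2 l; rewrite !ffunE; apply: inj_map.
  by case=> [x|] [y|] //= [] /eqP; rewrite eq_Tagged /= => /eqP->.
- by move=> m b i; rewrite ffunE size_map code_size.
- move=> m b; apply: leq_trans (Sd (tag b)); apply: leq_trans (code_bound (tagged b)).
  by apply: leq_sum => i _; rewrite ffunE pmap_omap size_map.
- by move=> m a x y b; rewrite /basis_ev /= dsumDE dsumZE !ffunE.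
- move=> m x x0; apply/val_inj/ffunP => i; rewrite [RHS]ffunE; apply/ffunP=> h.
  have := x0 (existT _ i h); rewrite /basis_ev /= => ->.
  by rewrite ffunE.
move=> m i s /code_insert[pi piE].
pose phi (b : basis m) : basis (incr m i) := existT _ (tag b) (hom_comp (tagged b) pi).
exists phi, (act (sub_mod A) pi); split=> [[j h]|x [j h]].
  rewrite /basis_code /= piE; congr pair; apply/ffunP => l; rewrite !ffunE.
  by case: eqP => // _; rewrite map_insert.
rewrite /basis_ev /= ffunE /= ffunE.
transitivity (\sum_(j' | j' == j)
   \sum_(h' : Defs.hom (X m) (S j') | phi (existT _ j' h') == existT _ j h)
     basis_ev x (existT _ j' h')).
  rewrite big_pred1_eq; apply: eq_bigl => h'.
  by rewrite /phi /= eq_Tagged.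
rewrite (sig_big_dep _ (fun j' (h' : Defs.hom (X m) (S j')) =>
    phi (existT _ j' h') == existT _ j h)
  (fun j' (h' : Defs.hom (X m) (S j')) => basis_ev x (existT _ j' h'))).
apply: eq_big => [[j' h']|[j' h']] //=.
by rewrite andb_idl // => /eqP/(congr1 tag) /= ->.
Qed.

End Submodule.

(** Pulling [A] and [B] back along the surjection [f] from the sum of principal projectives presents
    [N] as a quotient of two submodules of that sum, so its dimension is a difference of two known
    ones. *)
Lemma ev_poly_small (N : opmod k C) :
  small d N -> eventually_poly d (fun m => N (X m)).
Proof.
move=> [G [[n [S [Sd [K [phi [phi_act phi_bij]]]]]] [A [B [psi [psi_act psi_bij]]]]]].
set P := dsum_mod _ in K phi phi_act phi_bij.
have phi_inv Y : {g | cancel (phi Y) g /\ cancel g (phi Y)}.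
  by apply: cid; have [g] := phi_bij Y; exists g.
pose f Y (x : P Y) : G Y := sval (phi_inv Y) (lpi (K Y) x).
have phif Y x : phi Y (@f Y x) = lpi (K Y) x by rewrite (svalP (phi_inv Y)).2.
have phi_inj Y : injective (phi Y) by apply: bij_inj.
have fl Y : linear (@f Y).
  by move=> a x y; apply: phi_inj; rewrite linearP !phif linearP.
have fact Y Z (h : Defs.hom Y Z) x : f _ (act P h x) = act G h (f _ x).
  by apply: phi_inj; rewrite phi_act !phif /= quot_act_pi.
have fsurj Y y : exists x, @f Y x = y.
  exists (lrepr (phi Y y)); apply: phi_inj; by rewrite phif lreprK.
pose A' := preim_sub fl fact A; pose B' := preim_sub fl fact (ext_sub B).
have HA := ev_poly_submodule Sd A'; have HB := ev_poly_submodule Sd B'.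
apply: ev_poly_diff HA HB => m a b.
set Y := X m => Ha Hb.
pose g (x : sub_mod A' Y) : quot_mod B Y := lpi (B Y) (SubOb (valP x : f _ (val x) \in A Y)).
have gl : linear g.
  move=> c x y; rewrite /g -linearP; congr (lpi _ _); apply: val_inj.
  by rewrite /= fl.
have gs z : exists x, g x = z.
  have [x0 fx0] := fsurj _ (val (lrepr z)).
  have Ax0 : x0 \in A' Y by rewrite preim_subE fx0; apply: valP.
  exists (SubOb Ax0); rewrite -[z]lreprK; congr (lpi _ _); exact: val_inj.
have BA x : x \in B' Y -> x \in A' Y.
  move=> Bx; have /ext_predP[y _ yE] : f Y x \in ext_sub B Y := Bx.
  by have : f Y x \in A Y by rewrite -yE; apply: (valP y).
pose j (x : sub_mod B' Y) : sub_mod A' Y := SubOb (BA _ (valP x)).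
have jl : linear j by move=> c x y; apply: val_inj.
have ji : injective j by move=> x y /(congr1 val) xy; apply: val_inj; exact: xy.
(* Finite dimension of the quotient comes first, since [has_dim_extension] takes it as an
   assumption. *)
have [c Hc] := has_dim_quotient gl gs Ha.
exists c; first exact: has_dim_iso (linearP (psi Y)) (psi_bij Y) Hc.
apply: has_dim_unique Ha; rewrite addnC.
apply: has_dim_extension jl gl ji gs _ Hb Hc => x; split.
  rewrite -(raddf0 (lpi (B Y))) => /lpi_eq; rewrite subr0 => Bx.
  have B'x : val x \in B' Y by apply/ext_predP; exists (SubOb (valP x : f Y (val x) \in A Y)).
  by exists (SubOb B'x); apply: val_inj.
case=> u <-; rewrite -(raddf0 (lpi (B Y))); apply/lpi_eq; rewrite subr0.
have /ext_predP[y By yE] : f Y (val u) \in ext_sub B Y := valP u.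
suff -> : SubOb (valP (j u) : f Y (val (j u)) \in A Y) = y by [].
exact/val_inj/esym.
Qed.

Theorem ev_poly_smallish (M : opmod k C) :
  smallish M d -> eventually_poly d (fun m => M (X m)).
Proof.
move=> [n [F [Ffilt /ev_poly_small]]]; apply: ev_poly_sub_imp => m c.
exact: has_dim_graded.
Qed.

End WordCoded.

(** * Contractions as words *)

Section Contractions.

Lemma fiber_connect (T S : tree) (f : {ffun T -> S}) x y :
    is_contraction f -> f x = f y ->
  connect [rel u v | [&& f u == f x, f v == f x & adj u v]] x y.
Proof.
case/contractionP=> _ /(_ (f x))/andP[_ /forall_inP/(_ x)].
rewrite !inE eqxx => /(_ isT)/forall_inP/(_ y); rewrite !inE => fc xy.
rewrite xy eqxx in fc; apply: connect_sub (fc isT) => u v /=.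
by rewrite !inE -xy => ?; apply: connect1.
Qed.

(* The connected fibres of [f u] and [f v] cannot cross the cut of [T] at the
   edge [u v], so they lie on its two sides. *)
Lemma contraction_edge_inj (T S : tree) (f : {ffun T -> S}) u v u' v' :
    is_contraction f -> adj u v -> adj u' v' -> f u <> f v ->
  f u' = f u -> f v' = f v -> u' = u /\ v' = v.
Proof.
move=> fC uv uv' fuv fu fv; have [c [cu cv cc]] := tree_cut uv.
apply: (cc) => //.
  apply: contraT => cu'.
  have [a [b [/and3P[_ /eqP fb ab] ca cb]]] :=
    connect_cross (fiber_connect fC (esym fu)) cu cu'.
  by have [_ bv] := cc _ _ ab ca cb; case: fuv; rewrite -bv fb.
apply/negP=> cv'.
have [a [b [/and3P[/eqP fa _ ab] ca cb]]] := connect_cross (fiber_connect fC fv) cv' cv.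
by have [au _] := cc _ _ ab ca cb; case: fuv; rewrite -au fa fv.
Qed.

Lemma is_contractionP (T S : tree) (f : {ffun T -> S}) :
    (forall x y, adj x y -> f x = f y \/ adj (f x) (f y)) ->
    (forall z, exists x, f x = z) ->
    (forall x y, f x = f y ->
      connect [rel u v | [&& f u == f x, f v == f x & adj u v]] x y) ->
  is_contraction f.
Proof.
move=> fadj fsurj ffib; apply/contractionP; split=> // z; apply/andP; split.
  by have [x fx] := fsurj z; apply/set0Pn; exists x; rewrite !inE fx.
apply/forall_inP=> x; rewrite !inE => /eqP fx.
apply/forall_inP=> y; rewrite !inE => /eqP fy.
have := ffib x y; rewrite fx fy => /(_ erefl); apply: connect_sub => u v /= uv.
by apply: connect1; rewrite /= !inE.
Qed.

Lemma set2_eq (T : finType) (a b a' b' : T) :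
  [set a; b] = [set a'; b'] -> (a = a' /\ b = b') \/ (a = b' /\ b = a').
Proof.
move=> E.
have : a \in [set a'; b'] by rewrite -E set21.
have : b \in [set a'; b'] by rewrite -E set22.
have : a' \in [set a; b] by rewrite E set21.
have : b' \in [set a; b] by rewrite E set22.
rewrite !inE => /orP[]/eqP e1 /orP[]/eqP e2 /orP[]/eqP e3 /orP[]/eqP e4;
  by [left; split; congruence | right; split; congruence].
Qed.

End Contractions.

(** * Words recording the edges that are not contracted *)

Section DifferenceWords.

Variable r : nat.

(** [g1 l j] and [g2 l j] are to be the images of the near and the far end of the [j]-th new edge in
    direction [l], for sprouting and subdivision alike. *)
Definition diff_word (S : finType) (m : 'I_r -> nat) (g1 g2 : 'I_r -> nat -> S) :
    {ffun 'I_r -> seq (option S)} :=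
  [ffun l => mkseq (fun j => if g1 l j == g2 l j then None else Some (g2 l j)) (m l)].

Lemma size_diff_word (S : finType) m (g1 g2 : 'I_r -> nat -> S) l :
  size (diff_word m g1 g2 l) = m l.
Proof. by rewrite ffunE size_mkseq. Qed.

(** A letter gives the image of the far end outright, and [None] says that it is that of the near
    end. *)
Lemma diff_word_eq (S : finType) m (g1 g2 g1' g2' : 'I_r -> nat -> S) l j :
    diff_word m g1 g2 = diff_word m g1' g2' -> j < m l -> g1 l j = g1' l j ->
  g2 l j = g2' l j.
Proof.
move=> /ffunP/(_ l); rewrite !ffunE => /(congr1 (fun w => nth None w j)) E jm.
move: E; rewrite !nth_mkseq // => E e; move: E; rewrite e.
by case: eqP => [<-|_]; case: eqP => [<-|_] // [].
Qed.

(** The letters other than [None] correspond to uncontracted new edges, whose images are distinct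
    edges of [S]. *)
Lemma size_diff_word_le (S : tree) m (g1 g2 : 'I_r -> nat -> S) :
    (forall l j, j < m l -> g1 l j <> g2 l j -> adj (g1 l j) (g2 l j)) ->
    (forall l j l' j', j < m l -> j' < m l' -> g1 l j <> g2 l j ->
      [set g1 l j; g2 l j] = [set g1 l' j'; g2 l' j'] -> l = l' /\ j = j') ->
  \sum_l size (pmap id (diff_word m g1 g2 l)) <= num_edges S.
Proof.
move=> gadj ginj.
pose J : finType := {l : 'I_r & 'I_(m l)}.
pose Z := [set x : J | g1 (tag x) (tagged x : 'I__) != g2 (tag x) (tagged x : 'I__)].
have -> : \sum_l size (pmap id (diff_word m g1 g2 l)) = #|Z|.
  transitivity (\sum_l \sum_(j < m l) (g1 l j != g2 l j : nat)).
    apply: eq_bigr => l _; rewrite ffunE size_pmap count_map -sumn_count.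
    rewrite sumnE big_map -[X in iota 0 X]subn0 big_mkord.
    by apply: eq_bigr => j _ /=; case: eqP.
  rewrite (sig_big_dep _ (fun _ _ => true)
    (fun l (j : 'I_(m l)) => g1 l j != g2 l j : nat)) /=.
  by rewrite -sum1dep_card [RHS]big_mkcond; apply: eq_bigr => x _; case: eqP.
pose E (x : J) := [set g1 (tag x) (tagged x : 'I__); g2 (tag x) (tagged x : 'I__)].
rewrite -(card_in_imset (f := E)).
  apply/subset_leq_card/subsetP => _ /imsetP[x + ->]; rewrite inE => /eqP xZ.
  by apply/imsetP; exists (g1 (tag x) (tagged x : 'I__), g2 (tag x) (tagged x : 'I__));
    rewrite // inE /= gadj.
move=> [l j] [l' j']; rewrite !inE /= => /eqP gj _ gE.
have [ll jj] := ginj _ _ _ _ (ltn_ord j) (ltn_ord j') gj gE.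
by case: _ / ll j' jj {gE} => j' jj; congr existT; apply: val_inj.
Qed.

Lemma mkseq_insert (T : Type) (z : T) (f f' : nat -> T) n s :
    s <= n -> (forall j, j < s -> f' j = f j) -> f' s = z ->
    (forall j, s <= j -> j < n -> f' j.+1 = f j) ->
  mkseq f' n.+1 = insert s z (mkseq f n).
Proof.
move=> sn f1 f2 f3.
have -> : n.+1 = s + (n - s).+1 by lia.
rewrite /insert /mkseq iotaD map_cat /= -map_take -map_drop add0n take_iota drop_iota.
rewrite (minn_idPl sn) add0n f2; congr (_ ++ _ :: _).
  by apply/eq_in_map => j; rewrite mem_iota => /andP[_ /f1].
rewrite -[s.+1]add1n iotaDl -map_comp; apply/eq_in_map => j.
by rewrite mem_iota subnKC // => /andP[sj jn] /=; apply: f3.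
Qed.

(** The hypotheses describe contracting the [s]-th new edge in direction [i]: earlier edges keep
    their place, this one collapses, later ones are shifted by one. *)
Lemma diff_word_insert (S : finType) m (g1 g2 g1' g2' : 'I_r -> nat -> S) i s :
    s <= m i ->
    (forall l j, j < m l -> (l == i -> j < s) -> g1' l j = g1 l j /\ g2' l j = g2 l j) ->
    g1' i s = g2' i s ->
    (forall j, s <= j -> j < m i -> g1' i j.+1 = g1 i j /\ g2' i j.+1 = g2 i j) ->
  diff_word (incr m i) g1' g2' =
    upd (diff_word m g1 g2) i (insert s None (diff_word m g1 g2 i)).
Proof.
move=> si H1 H2 H3; apply/ffunP=> l; rewrite !ffunE /incr.
case: eqP => [->|/eqP li]; last first.
  rewrite addn0; apply/eq_in_map => j; rewrite mem_iota => /= jm.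
  by have [||-> ->] := H1 l j; rewrite ?(negbTE li).
rewrite addn1; apply: mkseq_insert => // [j js||j sj jm].
- by have [||-> ->] := H1 i j; first exact: leq_trans si.
- by rewrite H2 eqxx.
- by have [||-> ->] := H3 j.
Qed.

End DifferenceWords.

(** * Contractions of sprouted trees *)

Section SproutWords.

Variables (T : tree) (r : nat) (v : 'I_r -> T).
Implicit Types (m : 'I_r -> nat) (S : tree).

(* Total in [j], with junk value [v l] when [j >= m l]. *)
Definition sprout_pt m l j : sprout v m :=
  if insub j is Some j' then inr (existT (fun l => 'I_(m l)) l j') else inl (v l).

Lemma sprout_ptE m l (j : 'I_(m l)) :
  sprout_pt m l j = inr (existT (fun l => 'I_(m l)) l j).
Proof. by rewrite /sprout_pt valK. Qed.

Lemma sprout_pt_inj m l j l' j' : j < m l ->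
  sprout_pt m l j = sprout_pt m l' j' -> l = l' /\ j = j'.
Proof.
move=> jm; rewrite /sprout_pt insubT; case: insubP => // y _ yj' [ll].
case: _ / ll y yj' => y yj' /eqP; rewrite eq_Tagged /= => /eqP jy.
by split=> //; rewrite -yj' -jy.
Qed.

Lemma sprout_vertP m (x : sprout v m) :
  (exists a, x = inl a) \/ exists l j, j < m l /\ x = sprout_pt m l j.
Proof.
case: x => [a|[l j]]; [by left; exists a|right; exists l, j].
by rewrite sprout_ptE.
Qed.

Lemma sprout_adj_pt m l j : j < m l -> adj (inl (v l) : sprout v m) (sprout_pt m l j).
Proof. by move=> jm; rewrite /sprout_pt insubT /=. Qed.

Lemma sprout_adjP m (x y : sprout v m) : adj x y ->
  [\/ exists a b, [/\ x = inl a, y = inl b & adj a b],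
      exists l j, [/\ j < m l, x = inl (v l) & y = sprout_pt m l j] |
      exists l j, [/\ j < m l, y = inl (v l) & x = sprout_pt m l j]].
Proof.
case: x y => [a|[l j]] [b|[l' j']] //= => [ab|/eqP->|/eqP->].
- by constructor 1; exists a, b.
- by constructor 2; exists l', j'; rewrite sprout_ptE.
- by constructor 3; exists l, j; rewrite sprout_ptE.
Qed.

Definition sprout_code m S (h : contraction (sprout v m) S) :
    {ffun T -> S} * {ffun 'I_r -> seq (option S)} :=
  ([ffun x => val h (inl x)],
   diff_word m (fun l _ => val h (inl (v l))) (fun l j => val h (sprout_pt m l j))).

Lemma sprout_code_inj m S : injective (@sprout_code m S).
Proof.
move=> h h' [/ffunP e1 e2]; apply/val_inj/ffunP => x.
have e1' a : val h (inl a) = val h' (inl a) by have := e1 a; rewrite !ffunE.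
have [[a ->]|[l [j [jm ->]]]] := sprout_vertP x; first exact: e1'.
by apply: diff_word_eq e2 jm _.
Qed.

Lemma sprout_code_bound m S (h : contraction (sprout v m) S) :
  \sum_i size (pmap id ((sprout_code h).2 i)) <= num_edges S.
Proof.
case: h => h hC; rewrite /sprout_code /=; have [hadj _] := contractionP _ hC.
apply: size_diff_word_le => [l j jm ne|l j l' j' jm jm' ne /set2_eq hE].
  by case: (hadj _ _ (sprout_adj_pt jm)).
have e1 := sprout_adj_pt jm; have e2 := sprout_adj_pt jm'.
case: hE => -[E1 E2].
  have [_ /esym] := contraction_edge_inj hC e1 e2 ne (esym E1) (esym E2).
  exact: sprout_pt_inj.
(* With opposite orientations a new leaf would be a vertex of [T]. *)
rewrite adj_sym in e2.
have [e _] := contraction_edge_inj hC e1 e2 ne (esym E1) (esym E2).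
by move: e; rewrite /sprout_pt insubT.
Qed.

Section Drop.

Variables (m : 'I_r -> nat) (i : 'I_r) (s : nat).
Hypothesis sm : s <= m i.

(** Contracts the [s]-th new edge at [v i]; [sprout_pt] spares the casts between ordinals when later
    leaves are renumbered. *)
Definition drop_leaf (x : sprout v (incr m i)) : sprout v m :=
  match x with
  | inl a => inl a
  | inr (existT l j) =>
      if l != i then sprout_pt m l j
      else if j < s then sprout_pt m l j
      else if (j : nat) == s then inl (v l) else sprout_pt m l j.-1
  end.

Lemma drop_leaf_pt l j : j < incr m i l ->
  drop_leaf (sprout_pt (incr m i) l j) =
      if l != i then sprout_pt m l j
      else if j < s then sprout_pt m l j
      else if j == s then inl (v l) else sprout_pt m l j.-1.
Proof. by move=> jm; rewrite /sprout_pt insubT. Qed.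

(** The second case recovers [j] from [j0], which yields injectivity on the surviving leaves. *)
Lemma drop_leaf_ptP l j : j < incr m i l ->
  [/\ l = i, j = s & drop_leaf (sprout_pt (incr m i) l j) = inl (v l)] \/
  exists2 j0, j0 < m l & drop_leaf (sprout_pt (incr m i) l j) = sprout_pt m l j0 /\
    j = if (l == i) && (s <= j0) then j0.+1 else j0.
Proof.
move=> jm; rewrite drop_leaf_pt //; move: jm; rewrite /incr.
case: (eqVneq l i) => [->|li] /=; last by rewrite addn0 => jm; right; exists j.
move=> jm; case: ltngtP => js; [right|right|by left].
  by exists j; [lia|rewrite leqNgt js].
exists j.-1; first lia; split=> //; have -> : s <= j.-1 by lia.
by rewrite prednK //; lia.
Qed.

Lemma drop_leaf_contraction : is_contraction [ffun x => drop_leaf x].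
Proof.
have pt_adj l j : j < incr m i l ->
    drop_leaf (sprout_pt (incr m i) l j) = inl (v l) \/
    adj (inl (v l) : sprout v m) (drop_leaf (sprout_pt (incr m i) l j)).
  move=> /drop_leaf_ptP[[_ _ ->]|[j0 jm0 [-> _]]]; first by left.
  by right; apply: sprout_adj_pt.
apply: is_contractionP => [x y /sprout_adjP[]|z|x y].
- by move=> [a [b [-> -> ab]]]; right; rewrite !ffunE.
- by move=> [l [j [jm -> ->]]]; rewrite !ffunE /=; case: (pt_adj l j jm) => ?; auto.
- move=> [l [j [jm -> ->]]]; rewrite !ffunE.
  case: (pt_adj l j jm) => [->|ad]; [by left|right].
  by rewrite adj_sym; apply: ad.
- have [[a ->]|[l [j [jm ->]]]] := sprout_vertP z; first by exists (inl a); rewrite ffunE.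
  exists (sprout_pt (incr m i) l (if (l == i) && (s <= j) then j.+1 else j)).
  rewrite ffunE drop_leaf_pt; last first.
    by rewrite /incr; move: jm; case: (eqVneq l i) => [->|_] /= jm; [case: (leqP s j)|]; lia.
  case: eqP => [_|] //=; case: (leqP s j) => sj.
    by rewrite ltnNge leqW //= gtn_eqF.
  by rewrite sj.
rewrite !ffunE => exy.
(* A fibre is a single vertex or the two ends of the contracted edge. *)
suff [->|xy] : x = y \/ adj x y; first exact: connect0.
  by apply: connect1; rewrite /= !ffunE exy eqxx.
have pt_inl l j a : j < incr m i l ->
    drop_leaf (sprout_pt (incr m i) l j) = inl a ->
    adj (inl a : sprout v _) (sprout_pt (incr m i) l j).
  move=> jm; have [[_ _ ->] [<-]|[j0 jm0 [-> _]]] := drop_leaf_ptP jm.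
    exact: sprout_adj_pt.
  by rewrite /sprout_pt insubT.
move: exy; have [[a ->]|[l [j [jm ->]]]] := sprout_vertP x;
  have [[b ->]|[l' [j' [jm' ->]]]] := sprout_vertP y => exy.
- by left; case: exy => ->.
- by right; apply: pt_inl jm' (esym exy).
- by right; rewrite adj_sym; apply: pt_inl jm exy.
left; move: exy.
have [[-> -> ->]|[j0 jm0 [-> ->]]] := drop_leaf_ptP jm;
  have [[-> -> ->]|[j0' jm0' [-> ->]]] := drop_leaf_ptP jm' => //.
- by rewrite /sprout_pt insubT.
- by rewrite /sprout_pt insubT.
by move/(sprout_pt_inj jm0) => [-> ->].
Qed.

Definition drop_leaf_map : contraction (sprout v (incr m i)) (sprout v m) :=
  exist (fun f => is_true (is_contraction f)) _ drop_leaf_contraction.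

Lemma sprout_code_insert S (h : contraction (sprout v m) S) :
  sprout_code (contraction_comp h drop_leaf_map) =
    ((sprout_code h).1, upd (sprout_code h).2 i (insert s None ((sprout_code h).2 i))).
Proof.
have hE x : val (contraction_comp h drop_leaf_map) x = val h (drop_leaf x).
  by rewrite contraction_compE /= ffunE.
congr pair; first by apply/ffunP=> x; rewrite [LHS]ffunE hE [RHS]ffunE.
apply: diff_word_insert => // [l j jm js||j sj jm]; rewrite !hE drop_leaf_pt ?eqxx /=.
- by case: eqP js => [_ /(_ isT) -> //|].
- by rewrite /incr; lia.
- by rewrite ltnn.
- by rewrite /incr eqxx; lia.
- by rewrite ltnNge leqW //= gtn_eqF.
- by rewrite /incr eqxx; lia.
Qed.

End Drop.

End SproutWords.

(** * Contractions of subdivided trees *)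

Section SubdivisionWords.

Variables (T : tree) (r : nat) (e : edge_tuple T r).
Implicit Types (m : 'I_r -> nat) (S : tree).

(** Positions are naturals, to allow arithmetic on them; beyond [m l] the value is the default
    position 0. *)
Definition pre_pt m l j : pre_sub T m :=
  inr (existT (fun l => 'I_(m l).+1) l (inord j)).

Lemma pre_subP m (u : pre_sub T m) :
  (exists a, u = inl a) \/ exists l j, j <= m l /\ u = pre_pt m l j.
Proof.
case: u => [a|[l j]]; [by left; exists a|right; exists l, j].
by rewrite /pre_pt inord_val -ltnS.
Qed.

Lemma pre_pt_inj m l j l' j' : j <= m l -> j' <= m l' ->
  pre_pt m l j = pre_pt m l' j' -> l = l' /\ j = j'.
Proof.
move=> jm jm' []; move=> ll; case: _ / ll jm' => jm' /eqP.
rewrite eq_Tagged /= => /eqP/(congr1 val); rewrite /= !inordK //.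
Qed.

Lemma glue_pt m a l j : j <= m l ->
  glue e (inl a) (pre_pt m l j) =
    (a == src e l) && (j == 0) || (a == tgt e l) && (j == m l).
Proof. by move=> jm; rewrite /= inordK. Qed.

Lemma pre_adj_pt m l j l' j' : j <= m l -> j' <= m l' ->
  pre_adj e (pre_pt m l j) (pre_pt m l' j') =
    (l == l') && ((j.+1 == j') || (j'.+1 == j)).
Proof. by move=> jm jm'; rewrite /= !inordK. Qed.

Definition subdiv_pt m l j : subdiv e m := subpi e (pre_pt m l j).

Lemma subdiv_adj_pt m l j : j < m l -> adj (subdiv_pt m l j) (subdiv_pt m l j.+1).
Proof.
move=> jm; apply/sub_adjP; exists (pre_pt m l j), (pre_pt m l j.+1).
by split=> //; rewrite pre_adj_pt ?eqxx // ltnW.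
Qed.

Lemma subdiv_pt0 m l : subdiv_pt m l 0 = subdiv_image e m (src e l).
Proof. by apply/esym/subpi_glue; rewrite glue_pt ?eqxx. Qed.

Lemma subdiv_vertP m (x : subdiv e m) :
  (exists a, x = subdiv_image e m a) \/ exists l j, j <= m l /\ x = subdiv_pt m l j.
Proof.
have [u <-] := subpi_onto x.
have [[a ->]|[l [j [jm ->]]]] := pre_subP u; first by left; exists a.
by right; exists l, j.
Qed.

(** The cut at the first path edge is compatible with gluing. A path edge with the same ends after
    gluing also leaves that cut, so it is the same edge already before gluing. *)
Lemma subdiv_edge_inj m l j l' j' : j < m l -> j' < m l' ->
    [set subdiv_pt m l j; subdiv_pt m l j.+1] =
    [set subdiv_pt m l' j'; subdiv_pt m l' j'.+1] ->
  l = l' /\ j = j'.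
Proof.
move=> jm jm' E.
have pq : pre_adj e (pre_pt m l j) (pre_pt m l j.+1).
  by rewrite pre_adj_pt ?eqxx // ltnW.
have pq' : pre_adj e (pre_pt m l' j') (pre_pt m l' j'.+1).
  by rewrite pre_adj_pt ?eqxx // ltnW.
have [C [C1 [Cp Cq Cc] _]] := precut_ex pq.
have CE := compat_subpi C1.
case: (set2_eq E) => -[E1 E2].
  rewrite (CE _ _ E1) in Cp; rewrite (CE _ _ E2) in Cq.
  have [+ _] := Cc _ _ pq' Cp Cq.
  by case/pre_pt_inj => //; try exact: ltnW; move=> -> ->.
(* Opposite orientations would give both [j'.+1 = j] and [j' = j.+1]. *)
rewrite (CE _ _ E1) in Cp; rewrite (CE _ _ E2) in Cq.
rewrite pre_adj_sym in pq'; have [e1 e2] := Cc _ _ pq' Cp Cq.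
have [_ j1] := pre_pt_inj jm' (ltnW jm) e1.
have [_ j2] := pre_pt_inj (ltnW jm') jm e2.
lia.
Qed.

Definition subdiv_code m S (h : contraction (subdiv e m) S) :
    {ffun T -> S} * {ffun 'I_r -> seq (option S)} :=
  ([ffun x => val h (subdiv_image e m x)],
   diff_word m (fun l j => val h (subdiv_pt m l j))
               (fun l j => val h (subdiv_pt m l j.+1))).

(** The values along a path are recovered one after another, starting from [src e l]. *)
Lemma subdiv_code_inj m S : injective (@subdiv_code m S).
Proof.
move=> h h' [/ffunP e1 e2]; apply/val_inj/ffunP => x.
have e1' a : val h (subdiv_image e m a) = val h' (subdiv_image e m a).
  by have := e1 a; rewrite !ffunE.
have [[a ->]|[l [j [jm ->]]]] := subdiv_vertP x; first exact: e1'.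
elim: j jm => [_|j IHj jm]; first by rewrite subdiv_pt0 e1'.
exact: (diff_word_eq e2 jm (IHj (ltnW jm))).
Qed.

Lemma subdiv_code_bound m S (h : contraction (subdiv e m) S) :
  \sum_i size (pmap id ((subdiv_code h).2 i)) <= num_edges S.
Proof.
case: h => h hC; rewrite /subdiv_code /=; have [hadj _] := contractionP _ hC.
apply: size_diff_word_le => [l j jm ne|l j l' j' jm jm' ne /set2_eq hE].
  by case: (hadj _ _ (subdiv_adj_pt jm)).
have e1 := subdiv_adj_pt jm; have e2 := subdiv_adj_pt jm'.
apply: (subdiv_edge_inj jm jm'); case: hE => -[E1 E2].
  by have [-> ->] := contraction_edge_inj hC e1 e2 ne (esym E1) (esym E2).
rewrite adj_sym in e2.
have [<- <-] := contraction_edge_inj hC e1 e2 ne (esym E1) (esym E2).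
exact: setUC.
Qed.

Section Drop.

Variables (m : 'I_r -> nat) (i : 'I_r) (s : nat).
Hypothesis sm : s <= m i.

Let m' := incr m i.

(** Contracts the edge from [s] to [s.+1] on the [i]-th path; [add_pos] is a section of it that
    avoids [s.+1]. *)
Definition drop_pos (l : 'I_r) (j : nat) : nat :=
  if (l == i) && (s < j) then j.-1 else j.

Definition add_pos (l : 'I_r) (j : nat) : nat :=
  if (l == i) && (s < j) then j.+1 else j.

Lemma drop_pos_le l j : j <= m' l -> drop_pos l j <= m l.
Proof.
rewrite /m' /incr /drop_pos; case: (eqVneq l i) => [->|_] /=; last by rewrite addn0.
by case: (ltnP s j) => sj; lia.
Qed.

Lemma add_pos_le l j : j <= m l -> add_pos l j <= m' l.
Proof.
rewrite /m' /incr /add_pos; case: (eqVneq l i) => [->|_] /=; last by rewrite addn0.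
by case: (ltnP s j) => sj; lia.
Qed.

Lemma add_posK l j : drop_pos l (add_pos l j) = j.
Proof.
rewrite /drop_pos /add_pos; case: (l == i) => //=.
by case: (ltnP s j) => sj; rewrite ?ltnS ?(ltnW sj) // ltnNge sj.
Qed.

Lemma drop_pos_max l : drop_pos l (m' l) = m l.
Proof.
rewrite /m' /incr /drop_pos; case: (eqVneq l i) => [->|_] /=; last by rewrite addn0.
by rewrite addn1 ltnS sm.
Qed.

Lemma drop_pos0 l : drop_pos l 0 = 0.
Proof. by rewrite /drop_pos ltn0 andbF. Qed.

Lemma drop_posS l j :
  drop_pos l j.+1 = drop_pos l j \/ drop_pos l j.+1 = (drop_pos l j).+1.
Proof.
rewrite /drop_pos; case: (l == i) => /=; last by right.
by case: (ltngtP s j) => sj; case: (ltnP s j.+1) => sj'; lia.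
Qed.

Lemma drop_pos_eq l j j' : drop_pos l j = drop_pos l j' ->
  [\/ j = j', j.+1 = j' | j'.+1 = j].
Proof.
rewrite /drop_pos; case: (l == i) => /=; last by constructor 1.
case: (ltnP s j) => sj; case: (ltnP s j') => sj' E;
  [constructor 1|constructor 3|constructor 2|constructor 1]; lia.
Qed.

Definition pre_drop (u : pre_sub T m') : pre_sub T m :=
  match u with
  | inl a => inl a
  | inr (existT l j) => pre_pt m l (drop_pos l j)
  end.

Lemma pre_drop_pt l j : j <= m' l -> pre_drop (pre_pt m' l j) = pre_pt m l (drop_pos l j).
Proof. by move=> jm; rewrite /= inordK. Qed.

Lemma pre_drop_onto u : exists u', pre_drop u' = u.
Proof.
have [[a ->]|[l [j [jm ->]]]] := pre_subP u; first by exists (inl a).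
by exists (pre_pt m' l (add_pos l j)); rewrite pre_drop_pt ?add_posK ?add_pos_le.
Qed.

Lemma pre_drop_glue u v : glue e u v -> glue e (pre_drop u) (pre_drop v).
Proof.
have [[a ->]|[l' [j' [jm' ->]]]] := pre_subP u; last by [].
have [[b ->]|[l [j [jm ->]]]] := pre_subP v; first by [].
rewrite glue_pt // pre_drop_pt // glue_pt ?drop_pos_le //.
case/orP=> /andP[-> /eqP->] /=; first by rewrite drop_pos0.
by rewrite drop_pos_max eqxx orbT.
Qed.

(** Serves to lift chains of gluings when fibres are shown to be connected. *)
Lemma pre_drop_glue_lift u v : glue e u v ->
  exists u' v', [/\ pre_drop u' = u, pre_drop v' = v & glue e u' v'].
Proof.
have [[a ->]|[l' [j' [jm' ->]]]] := pre_subP u; last by [].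
have [[b ->]|[l [j [jm ->]]]] := pre_subP v; first by [].
rewrite glue_pt // => /orP[]/andP[al /eqP->]; exists (inl a).
  exists (pre_pt m' l 0); split=> //; first by rewrite pre_drop_pt // drop_pos0.
  by rewrite glue_pt // al.
exists (pre_pt m' l (m' l)); split=> //; first by rewrite pre_drop_pt // drop_pos_max.
by rewrite glue_pt // al eqxx orbT.
Qed.

Lemma pre_drop_adj u v : pre_adj e u v ->
  pre_drop u = pre_drop v \/ pre_adj e (pre_drop u) (pre_drop v).
Proof.
have [[a ->]|[l [j [jm ->]]]] := pre_subP u;
  have [[b ->]|[l' [j' [jm' ->]]]] := pre_subP v => //; first by right.
rewrite pre_adj_pt // => /andP[/eqP ll E]; case: _ / ll jm' E => jm' E.
rewrite !pre_drop_pt // pre_adj_pt ?drop_pos_le // eqxx /=.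
case/orP: E => /eqP <-.
  by case: (drop_posS l j) => ->; [left | right; rewrite eqxx].
by case: (drop_posS l j') => ->; [left | right; rewrite eqxx orbT].
Qed.

Lemma pre_drop_eq u v : pre_drop u = pre_drop v -> u = v \/ pre_adj e u v.
Proof.
have [[a ->]|[l [j [jm ->]]]] := pre_subP u;
  have [[b ->]|[l' [j' [jm' ->]]]] := pre_subP v => //.
  by case=> ->; left.
rewrite !pre_drop_pt // => /pre_pt_inj; rewrite !drop_pos_le // => -[//|//|ll].
case: _ / ll jm' => jm' /drop_pos_eq[->|E|E]; [by left|right|right];
  by rewrite pre_adj_pt // -E !eqxx ?orbT.
Qed.

Definition drop_vert (x : subdiv e m') : subdiv e m := subpi e (pre_drop (repr x)).

Lemma drop_vertE u : drop_vert (subpi e u) = subpi e (pre_drop u).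
Proof.
apply/eqP; pose D w := subpi e (pre_drop w) == subpi e (pre_drop u).
change (is_true (D (repr (subpi e u)))).
rewrite (@compat_subpi _ _ e m' D _ _ u) /D ?eqxx //; last exact: reprK.
by move=> w w' /pre_drop_glue/subpi_glue ->.
Qed.

(** For connected fibres, the chain of gluings between the images of [u] and [v] is lifted link by
    link: points with the same image under [pre_drop] are equal or adjacent, and the ends of a
    lifted link are the same vertex. *)
Lemma drop_vert_contraction : is_contraction [ffun x => drop_vert x].
Proof.
apply: is_contractionP => [x y /sub_adjP[u [v [<- <- uv]]]|z|x y].
- rewrite !ffunE !drop_vertE; case: (pre_drop_adj uv) => [->|uv']; first by left.
  by right; apply/sub_adjP; exists (pre_drop u), (pre_drop v).
- have [u <-] := subpi_onto z; have [u' <-] := pre_drop_onto u.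
  by exists (subpi e u'); rewrite ffunE drop_vertE.
have [u <-] := subpi_onto x; have [v <-] := subpi_onto y.
rewrite !ffunE; set z := drop_vert _ => vz.
have uz : drop_vert (subpi e u) = z by []; clearbody z.
set R := [rel _ _ | _].
have Rpre u1 v1 : pre_drop u1 = pre_drop v1 -> drop_vert (subpi e u1) = z ->
    connect R (subpi e u1) (subpi e v1).
  move=> E u1z; have [->|uv] := pre_drop_eq E; first exact: connect0.
  apply: connect1; rewrite /= !ffunE u1z drop_vertE -E -drop_vertE u1z eqxx /=.
  by apply/sub_adjP; exists u1, v1.
have /eqmodP/connectP[p] : subpi e (pre_drop u) = subpi e (pre_drop v).
  by rewrite -!drop_vertE uz.
elim: p u uz {vz} => [|w p IHp] u uz /=; first by move=> _ E; apply: Rpre.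
case/andP=> uw pw ev.
have [u' [v' [u'u v'w u'v']]] : exists u' v',
   [/\ pre_drop u' = pre_drop u, pre_drop v' = w & subpi e u' = subpi e v'].
  case/orP: uw => /pre_drop_glue_lift[u' [v' [E1 E2 /subpi_glue E3]]].
    by exists u', v'.
  by exists v', u'.
apply: (@connect_trans _ _ (subpi e u')); first exact: Rpre.
rewrite u'v'; apply: IHp.
- by rewrite -u'v' drop_vertE u'u -drop_vertE.
- by rewrite v'w.
- by rewrite v'w.
Qed.

Definition drop_vert_map : contraction (subdiv e m') (subdiv e m) :=
  exist (fun f => is_true (is_contraction f)) _ drop_vert_contraction.

Lemma drop_vert_image a : val drop_vert_map (subdiv_image e m' a) = subdiv_image e m a.
Proof. by rewrite ffunE drop_vertE. Qed.

Lemma subdiv_code_insert S (h : contraction (subdiv e m) S) :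
  subdiv_code (contraction_comp h drop_vert_map) =
    ((subdiv_code h).1, upd (subdiv_code h).2 i (insert s None ((subdiv_code h).2 i))).
Proof.
have hE x : val (contraction_comp h drop_vert_map) x = val h (val drop_vert_map x).
  by rewrite contraction_compE.
have ptE l j : j <= m' l ->
    val drop_vert_map (subdiv_pt m' l j) = subdiv_pt m l (drop_pos l j).
  by move=> jm; rewrite ffunE drop_vertE pre_drop_pt.
congr pair.
  by apply/ffunP=> x; rewrite [LHS]ffunE hE [RHS]ffunE drop_vert_image.
apply: diff_word_insert => // [l j jm js||j sj jm]; rewrite !hE !ptE /m' /incr ?eqxx; try lia.
- rewrite /drop_pos; case: eqP js => [_ /(_ isT) js|] //=.
  by rewrite ltnNge ltnW //= ltnNge js.
- by rewrite /drop_pos eqxx ltnn /= ltnSn.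
- by rewrite /drop_pos eqxx /= !ltnS sj leqW.
Qed.

End Drop.

End SubdivisionWords.

(** In each category the contraction of one new edge has to be a morphism. In the rooted case this
    holds because it maps the root to the root; in the other categories every contraction is a
    morphism. *)
Theorem theorem1p4 (k : fieldType) (d : nat) :
  ((forall M : opmod k cat_T, smallish M d ->
      forall (T : tree) (r : nat) (e : edge_tuple T r),
        eventually_poly d (fun m : 'I_r -> nat => M (subdiv e m))) /\
   (forall M : opmod k cat_RT, smallish M d ->
      forall (T : rtree) (r : nat) (e : edge_tuple T r),
        eventually_poly d (fun m : 'I_r -> nat => M (subdiv_rt e m))) /\
   (forall l : nat, (2 <= l)%N ->
      forall M : opmod k (cat_Tl l), smallish M d ->
      forall (T : cat_Tl l) (r : nat) (e : edge_tuple (utree T) r),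
        eventually_poly d (fun m : 'I_r -> nat => M (subdiv_tl e m)))) /\
  ((forall M : opmod k cat_T, smallish M d ->
      forall (T : tree) (r : nat) (v : 'I_r -> T), injective v ->
        eventually_poly d (fun m : 'I_r -> nat => M (sprout v m))) /\
   (forall M : opmod k cat_RT, smallish M d ->
      forall (T : rtree) (r : nat) (v : 'I_r -> T), injective v ->
        eventually_poly d (fun m : 'I_r -> nat => M (sprout_rt v m)))).
Proof.
split; [split; [|split]|split].
- move=> M Mk T r e.
  apply: (@ev_poly_smallish cat_T r (fun m => subdiv e m)
     (fun S => {ffun T -> S} : finType) (fun S => vert S)
     (fun m S h => subdiv_code (val h))) Mk.
  + by move=> m S h h' /subdiv_code_inj/val_inj.
  + by move=> m S h i; apply: size_diff_word.
  + by move=> m S h; apply: subdiv_code_bound.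
  + move=> m i s sm; exists (exist _ (drop_vert_map e sm) isT) => S h.
    exact: subdiv_code_insert.
- move=> M Mk T r e.
  apply: (@ev_poly_smallish cat_RT r (fun m => subdiv_rt e m)
     (fun S => {ffun T -> S} : finType) (fun S => vert S)
     (fun m S h => subdiv_code (val h))) Mk.
  + by move=> m S h h' /subdiv_code_inj/val_inj.
  + by move=> m S h i; apply: size_diff_word.
  + by move=> m S h; apply: subdiv_code_bound.
  + move=> m i s sm.
    have rt : @root_preserving (subdiv_rt e (incr m i)) (subdiv_rt e m) (drop_vert_map e sm).
      by apply/eqP; apply: drop_vert_image.
    exists (exist _ (drop_vert_map e sm) rt) => S h.
    exact: subdiv_code_insert.
- move=> l _ M Mk T r e.
  apply: (@ev_poly_smallish (cat_Tl l) r (fun m => subdiv_tl e m)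
     (fun S => {ffun utree T -> utree S} : finType) (fun S => vert (utree S))
     (fun m S h => subdiv_code (val h))) Mk.
  + by move=> m S h h' /subdiv_code_inj/val_inj.
  + by move=> m S h i; apply: size_diff_word.
  + by move=> m S h; apply: subdiv_code_bound.
  + move=> m i s sm; exists (exist _ (drop_vert_map e sm) isT) => S h.
    exact: subdiv_code_insert.
- move=> M Mk T r v _.
  apply: (@ev_poly_smallish cat_T r (fun m => sprout v m)
     (fun S => {ffun T -> S} : finType) (fun S => vert S)
     (fun m S h => sprout_code (val h))) Mk.
  + by move=> m S h h' /sprout_code_inj/val_inj.
  + by move=> m S h i; apply: size_diff_word.
  + by move=> m S h; apply: sprout_code_bound.
  + move=> m i s sm; exists (exist _ (drop_leaf_map v sm) isT) => S h.
    exact: sprout_code_insert.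
- move=> M Mk T r v _.
  apply: (@ev_poly_smallish cat_RT r (fun m => sprout_rt v m)
     (fun S => {ffun T -> S} : finType) (fun S => vert S)
     (fun m S h => sprout_code (val h))) Mk.
  + by move=> m S h h' /sprout_code_inj/val_inj.
  + by move=> m S h i; apply: size_diff_word.
  + by move=> m S h; apply: sprout_code_bound.
  + move=> m i s sm.
    have rt : @root_preserving (sprout_rt v (incr m i)) (sprout_rt v m) (drop_leaf_map v sm).
      by apply/eqP; rewrite ffunE.
    exists (exist _ (drop_leaf_map v sm) rt) => S h.
    exact: sprout_code_insert.
Qed.
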